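(* Let $k\ge3$ and $\theta\in\mathcal{P}([k])$ with $\theta(i)>0$ for all $i$. Then the generic value satisfies $F_\theta(n_1,\dots,n_k)=n_1^{\theta(1)}\cdots n_k^{\theta(k)}$ if and only if $\mathbb{C}^{n_1}\otimes\cdots\otimes\mathbb{C}^{n_k}$ contains a pure quantum state with completely mixed marginals.
   Context: Lower quantum functional: for nonzero $t\in\mathbb{C}^{n_1}\otimes\cdots\otimes\mathbb{C}^{n_k}$ and nonzero $\psi$, let $\rho=|\psi\rangle\langle\psi|/\langle\psi|\psi\rangle$ (standard inner product) with one-party marginals $\rho_j$ (partial trace over all other factors), $H_\theta(\psi)=\sum_j\theta(j)H(\rho_j)$ with $H(\rho)=-\operatorname{Tr}\rho\log_2\rho$; $E_\theta(t)=\sup_{A_j\in\mathrm{GL}_{n_j}(\mathbb{C})}H_\theta((A_1\otimes\cdots\otimes A_k)t)$ and $F_\theta(t)=2^{E_\theta(t)}$, $F_\theta(0)=0$. For fixed format $(n_1,\dots,n_k)$ there is a nonempty Zariski open subset of $\mathbb{C}^{n_1}\otimes\cdots\otimes\mathbb{C}^{n_k}$ on which $F_\theta$ is constant; this constant (well defined since nonempty Zariski open sets of this irreducible space intersect) is the generic value $F_\theta(n_1,\dots,n_k)$. A pure quantum state with completely mixed marginals is a unit vector $\psi$ such that each marginal $\rho_i$ of $|\psi\rangle\langle\psi|$ has entropy $\log_2n_i$ (equivalently $\rho_i=I/n_i$). *)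

(* Defs.v *)
From HB Require Import structures.
From mathcomp Require Import all_boot all_order all_algebra.
From mathcomp Require Import all_classical all_reals all_analysis.
From mathcomp Require Import spectral complex.
(* mpoly is required but not imported: its notations clash with those of
   mathcomp-analysis. *)
From mathcomp Require mpoly.

Set Implicit Arguments.
Unset Strict Implicit.
Unset Printing Implicit Defensive.

Import Order.TTheory GRing.Theory Num.Theory.
Local Open Scope classical_set_scope.
Local Open Scope ring_scope.

(* Tensors of C^(n 0) (x) ... (x) C^(n (k-1)) are given by their coordinates in
   the product basis, which is indexed by multi-indices. *)
Notation mindex n := {dffun forall j, 'I_(n j)}.

Definition tensor (R : realType) (k : nat) (n : 'I_k -> nat) : zmodType :=
  {ffun mindex n -> R[i]}.

Section QuantumFunctional.
Variables (R : realType) (k : nat) (n : 'I_k -> nat).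

Definition inner (u v : tensor R n) : R[i] := \sum_x (u x)^* * v x.

Definition tensor_act (A : forall j, 'M[R[i]]_(n j)) (t : tensor R n) :
    tensor R n :=
  [ffun x : mindex n => \sum_(y : mindex n) (\prod_j A j (x j) (y j)) * t y].

(* Operators on the tensor space are given by their matrix entries. *)
Definition density (psi : tensor R n) : mindex n -> mindex n -> R[i] :=
  fun x y => psi x * (psi y)^* / inner psi psi.

Definition marginal (rho : mindex n -> mindex n -> R[i]) (j : 'I_k) :
    'M[R[i]]_(n j) :=
  \matrix_(a, b) \sum_(x : mindex n | x j == a)
    \sum_(y : mindex n | (y j == b) && [forall (i | i != j), x i == y i])
      rho x y.

Definition log2 (x : R) : R := ln x / ln 2.

(* Functional calculus: A = P^-1 *m diag_mx d *m P with P unitary, for A normal.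
   Since ln 0 = 0, the logarithm vanishes on the kernel of A, which gives the
   usual convention 0 log 0 = 0 in the entropy. *)
Definition log2mx (m : nat) (A : 'M[R[i]]_m) : 'M[R[i]]_m :=
  invmx (spectralmx A)
    *m diag_mx (map_mx (fun z => (log2 (complex.Re z))%:C%C) (spectral_diag A))
    *m spectralmx A.

Definition entropy (m : nat) (rho : 'M[R[i]]_m) : R :=
  - complex.Re (\tr (rho *m log2mx rho)).

Definition entropy_theta (theta : 'I_k -> R) (psi : tensor R n) : R :=
  \sum_j theta j * entropy (marginal (density psi) j).

Definition E_lower (theta : 'I_k -> R) (t : tensor R n) : R :=
  sup [set h | exists2 A : forall j, 'M[R[i]]_(n j),
         forall j, A j \in unitmx & h = entropy_theta theta (tensor_act A t)].

Definition F_lower (theta : 'I_k -> R) (t : tensor R n) : R :=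
  if t == 0 then 0 else 2 `^ E_lower theta t.

Definition tensor_coord (t : tensor R n) : 'I_#|mindex n| -> R[i] :=
  fun i => t (enum_val i).

Definition zariski_closed (Z : set (tensor R n)) : Prop :=
  exists S : set (mpoly.mpoly #|mindex n| R[i]),
    Z = [set t | forall p, S p -> mpoly.meval (tensor_coord t) p = 0].

Definition zariski_open (U : set (tensor R n)) : Prop := zariski_closed (~` U).

Definition is_generic_value (theta : 'I_k -> R) (c : R) : Prop :=
  exists U : set (tensor R n),
    [/\ zariski_open U, U !=set0 & forall t, U t -> F_lower theta t = c].

Definition completely_mixed_marginals (psi : tensor R n) : Prop :=
  inner psi psi = 1 /\
  forall j, entropy (marginal (density psi) j) = log2 (n j)%:R.

End QuantumFunctional.

(* The constant satisfying is_generic_value, which exists and is unique; the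
   default value 0 of xget is not used. *)
Definition generic_value (R : realType) (k : nat) (n : 'I_k -> nat)
    (theta : 'I_k -> R) : R :=
  xget 0 [set c | is_generic_value n theta c].

Definition prob_distr (R : realType) (k : nat) (theta : 'I_k -> R) : Prop :=
  (forall j, 0 <= theta j) /\ \sum_j theta j = 1.

(* Main.v *)
Require Import Defs.
From HB Require Import structures.
From mathcomp Require Import all_boot all_order all_algebra.
From mathcomp Require Import all_classical all_reals all_analysis.
From mathcomp Require Import sesquilinear spectral complex closed_field ring lra.
From mathcomp Require mpoly.
Import (canonicals) mpoly.

Set Implicit Arguments.
Unset Strict Implicit.
Unset Printing Implicit Defensive.

Import Order.TTheory GRing.Theory Num.Theory.
Import numFieldNormedType.Exports.
Local Open Scope classical_set_scope.
Local Open Scope ring_scope.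
Local Open Scope sesquilinear_scope.

(** If the generic value is the maximal one, some tensor [t] has vectors in its
    GL-orbit whose marginals are arbitrarily close to uniform; a limit point of
    the normalised vectors on the compact unit sphere is the required state.

    Conversely, let [cap t] be the infimum over invertible [A] of
    [|A t|^2 prod_j |det A_j|^(-2/n_j)].  If [cap t > 0], then near-minimisers
    have nearly uniform marginals, so [F_lower theta t] is maximal.  Writing
    [A_j^* A_j] in diagonal form shows that a tensor with [cap t = 0] is a limit
    of tensors in the set [null], those which some invertible [A] moves into the
    span of basis vectors of negative weight for a traceless diagonal matrix.
    Membership in [null] is a first-order property over an algebraically closed
    field, so by quantifier elimination it is constant on some nonempty set
    [q <> 0].  A state with uniform marginals has a neighbourhood on which [cap]
    is bounded below, hence disjoint from [null]; so [null] lies in [q = 0], and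
    so does its closure.  Thus [cap > 0] wherever [q <> 0]. *)

(** * The squared modulus on the complex numbers *)

Section ComplexModulus.
Variable R : realType.
Implicit Types z w : R[i].

Definition normsq z : R := complex.Re z ^+ 2 + complex.Im z ^+ 2.

Lemma normsq_ge0 z : 0 <= normsq z.
Proof. by rewrite addr_ge0 // sqr_ge0. Qed.

Lemma normsqE z : (normsq z)%:C%C = z * z^*.
Proof. by rewrite /normsq add_Re2_Im2 normCK. Qed.

Lemma normsqE' z : (normsq z)%:C%C = z^* * z.
Proof. by rewrite normsqE mulrC. Qed.

Lemma real_complexM (x y : R) : (x * y)%:C%C = x%:C%C * y%:C%C :> R[i].
Proof. exact: rmorphM. Qed.

Lemma real_complex_sum (I : Type) (r : seq I) (P : pred I) (F : I -> R) :
  (\sum_(i <- r | P i) F i)%:C%C = \sum_(i <- r | P i) (F i)%:C%C :> R[i].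
Proof. exact: (rmorph_sum (real_complex R)). Qed.

Lemma real_complex_prod (I : Type) (r : seq I) (P : pred I) (F : I -> R) :
  (\prod_(i <- r | P i) F i)%:C%C = \prod_(i <- r | P i) (F i)%:C%C :> R[i].
Proof. exact: (rmorph_prod (real_complex R)). Qed.

Lemma conj_real_complex (x : R) : (x%:C%C : R[i])^* = x%:C%C.
Proof. by apply/CrealP; apply/complex_realP; exists x. Qed.

Lemma normsqM z w : normsq (z * w) = normsq z * normsq w.
Proof. by apply: complexI; rewrite real_complexM !normsqE rmorphM mulrACA. Qed.

Lemma normsqC (x : R) : normsq x%:C%C = x ^+ 2.
Proof. by rewrite /normsq /= expr0n addr0. Qed.

Lemma normsq_eq0 z : (normsq z == 0) = (z == 0).
Proof.
by rewrite -(inj_eq (@complexI R)) normsqE mulf_eq0 conjC_eq0 orbb.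
Qed.

Lemma normsq_gt0 z : (0 < normsq z) = (z != 0).
Proof. by rewrite lt_def normsq_ge0 andbT normsq_eq0. Qed.

Lemma normsqD_le z w : normsq (z + w) <= 2 * normsq z + 2 * normsq w.
Proof.
case: z w => [a b] [c d]; rewrite /normsq /=.
have := sqr_ge0 (a - c); have := sqr_ge0 (b - d); nra.
Qed.

Lemma normsqN z : normsq (- z) = normsq z.
Proof. by case: z => a b; rewrite /normsq /= !sqrrN. Qed.

End ComplexModulus.

(** * Matrix tuples acting on tensors; marginals as expectations of local operators *)

Section TensorAlgebra.
Variables (R : realType) (k : nat) (n : 'I_k -> nat).
Notation C := R[i].
Implicit Types (A B : forall j, 'M[C]_(n j)) (t u v : tensor R n).

(** Distributivity for factors whose index types differ: the types ['I_(n j)] are embedded in their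
    tagged union, where the nondependent distributive law applies. *)
Lemma prod_sum_mindex (F : forall j, 'I_(n j) -> C) :
  \prod_j \sum_(a : 'I_(n j)) F j a = \sum_(x : mindex n) \prod_j F j (x j).
Proof.
rewrite (reindex (@dffun_of_fprod _ _)) /=; last first.
  by exists (@fprod_of_dffun _ _) => ? _;
    [exact: dffun_of_fprodK|exact: fprod_of_dffunK].
under [RHS]eq_bigr => x _ do under eq_bigr => j _ do
  rewrite ffunE -[F j (x j)](ffunE (F j) (x j)).
rewrite (@big_fprod _ _ _ _ _ _ _ (fun j => [ffun a => F j a])) /=.
rewrite -(@bigA_distr_big_dep _ _ _ _ _ _ _
  (fun i => [pred u | u \in tagged_with (fun x : 'I_k => 'I_(n x)) i])
  (fun i => untag 0 [ffun a => F i a])) /=.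
apply: eq_bigr => j _; rewrite -(big_tag (fun j => fun_of_fin [ffun a => F j a])).
by apply: eq_bigr => a _; rewrite ffunE.
Qed.

Lemma tensor_actM A B t :
  tensor_act A (tensor_act B t) = tensor_act (fun j => A j *m B j) t.
Proof.
apply/ffunP => x; rewrite !ffunE.
under eq_bigr => y _ do rewrite ffunE mulr_sumr.
rewrite exchange_big /=; apply: eq_bigr => z _.
under eq_bigr => y _ do rewrite mulrA -big_split /=.
rewrite -mulr_suml; congr (_ * _).
under [RHS]eq_bigr => j _ do rewrite mxE.
by rewrite (prod_sum_mindex (fun j a => A j (x j) a * B j a (z j))).
Qed.

Lemma prod_eq_mindex (x y : mindex n) :
  \prod_j ((x j == y j)%:R : C) = (x == y)%:R.
Proof.
case: eqP => [->|xy]; first by rewrite big1 // => j _; rewrite eqxx.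
case: (pickP (fun j => x j != y j)) => [j xyj|xyj].
  by rewrite (bigD1 j) //= (negbTE xyj) mul0r.
by case: xy; apply/ffunP => j; apply/eqP; apply: negbFE; exact: xyj.
Qed.

Lemma tensor_act_diag (d : forall j, 'rV[C]_(n j)) t x :
  tensor_act (fun j => diag_mx (d j)) t x = (\prod_j d j 0 (x j)) * t x.
Proof.
rewrite ffunE (bigD1 x) //= [X in _ + X]big1 ?addr0 => [|y yx].
  by congr (_ * _); apply: eq_bigr => j _; rewrite mxE eqxx mulr1n.
under eq_bigr => j _ do rewrite mxE -mulr_natr.
by rewrite big_split /= prod_eq_mindex eq_sym (negbTE yx) mulr0 mul0r.
Qed.

Lemma tensor_act1 t : tensor_act (fun j => 1%:M) t = t.
Proof.
apply/ffunP => x; rewrite ffunE (bigD1 x) //= [X in _ + X]big1 ?addr0.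
  by rewrite big1 ?mul1r // => j _; rewrite mxE eqxx.
move=> y yx; under eq_bigr => j _ do rewrite mxE.
by rewrite prod_eq_mindex eq_sym (negbTE yx) mul0r.
Qed.

Lemma tensor_actB A t u :
  tensor_act A (t - u) = tensor_act A t - tensor_act A u.
Proof.
apply/ffunP => x; rewrite !ffunE -sumrB; apply: eq_bigr => y _.
by rewrite !ffunE mulrBr.
Qed.

Lemma eq_tensor_act A B t :
  (forall j, A j = B j) -> tensor_act A t = tensor_act B t.
Proof.
move=> AB; apply/ffunP => x; rewrite !ffunE; apply: eq_bigr => y _.
by congr (_ * _); apply: eq_bigr => j _; rewrite AB.
Qed.

Lemma tensor_actVK A t : (forall j, A j \in unitmx) ->
  tensor_act (fun j => invmx (A j)) (tensor_act A t) = t.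
Proof.
move=> uA; rewrite tensor_actM (eq_tensor_act (B := fun j => 1%:M)) ?tensor_act1 //.
by move=> j; rewrite mulVmx.
Qed.

Lemma inner_act A u v :
  inner (tensor_act A u) v = inner u (tensor_act (fun j => (A j)^t*) v).
Proof.
rewrite /inner.
under eq_bigr => x _ do rewrite ffunE rmorph_sum mulr_suml /=.
rewrite exchange_big /=; apply: eq_bigr => y _; rewrite ffunE mulr_sumr.
apply: eq_bigr => x _; rewrite rmorphM rmorph_prod /= mulrAC mulrC.
rewrite mulrA mulrAC -!mulrA; congr (_ * _); rewrite mulrC; congr (_ * _).
by apply: eq_bigr => j _; rewrite !mxE.
Qed.

Definition sqnorm t : R := \sum_x normsq (t x).

Lemma sqnormE t : (sqnorm t)%:C%C = inner t t.
Proof.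
by rewrite /sqnorm real_complex_sum; apply: eq_bigr => x _; rewrite normsqE'.
Qed.

Lemma sqnorm_ge0 t : 0 <= sqnorm t.
Proof. by apply: sumr_ge0 => x _; exact: normsq_ge0. Qed.

Lemma sqnorm_eq0 t : (sqnorm t == 0) = (t == 0).
Proof.
rewrite psumr_eq0 => [|x _]; last exact: normsq_ge0.
apply/allP/eqP => [t0|-> x _]; last by rewrite /= ffunE normsq_eq0.
by apply/ffunP => x; have := t0 x (mem_index_enum _);
  rewrite normsq_eq0 ffunE => /eqP.
Qed.

Lemma sqnorm_gt0 t : (0 < sqnorm t) = (t != 0).
Proof. by rewrite lt_def sqnorm_ge0 andbT sqnorm_eq0. Qed.

Lemma sqnorm_act A t :
  (sqnorm (tensor_act A t))%:C%C =
  inner t (tensor_act (fun j => (A j)^t* *m A j) t).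
Proof. by rewrite sqnormE inner_act tensor_actM. Qed.

Lemma sqnorm_unitary A t : (forall j, A j \is unitarymx) ->
  sqnorm (tensor_act A t) = sqnorm t.
Proof.
move=> uA; apply: complexI; rewrite sqnorm_act sqnormE; congr inner.
rewrite -[RHS]tensor_act1; apply: eq_tensor_act => j.
by rewrite -invmx_unitary // mulVmx // unitarymx_unit.
Qed.

Definition act1 j (M : 'M[C]_(n j)) : forall i, 'M[C]_(n i) :=
  @dfwith _ (fun i => 'M[C]_(n i)) (fun i => 1%:M) j M.
Arguments act1 : clear implicits.

Lemma act1_in j M : act1 j M j = M.
Proof. by rewrite /act1 dfwithin. Qed.

Lemma act1_out j M i : j != i -> act1 j M i = 1%:M.
Proof. by move=> ji; rewrite /act1 dfwithout. Qed.

(** The characterisation of the partial trace by expectations of operators acting on one factor.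
    Trace, positivity and unitary covariance of marginals are all derived from it. *)
Lemma inner_act1 t j M : t != 0 ->
  inner t (tensor_act (act1 j M) t) =
  inner t t * \tr (M *m marginal (density t) j).
Proof.
rewrite -sqnorm_gt0 => t0.
have it0 : inner t t != 0 by rewrite -sqnormE (inj_eq (@complexI R)) gt_eqF.
transitivity (\sum_(y : mindex n)
    \sum_(x : mindex n | [forall (i | i != j), x i == y i])
      M (y j) (x j) * (t x * (t y)^*)).
  apply: eq_bigr => y _; rewrite ffunE mulr_sumr [RHS]big_mkcond /=.
  apply: eq_bigr => x _; rewrite (bigD1 j) //= act1_in.
  case: ifPn => [/forall_inP xy|].
    rewrite big1 => [|i ij]; first by rewrite mulr1; ring.
    by rewrite act1_out 1?eq_sym // mxE -(eqP (xy i ij)) eqxx.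
  rewrite negb_forall_in => /exists_inP[i ij xyi].
  rewrite (bigD1 i) //= act1_out 1?eq_sym // mxE eq_sym (negbTE xyi) /=.
  by rewrite !(mul0r, mulr0).
rewrite (partition_big (fun y : mindex n => y j) predT) //= mulr_sumr.
apply: eq_bigr => b _; rewrite mxE mulr_sumr.
rewrite (exchange_big_dep predT) //=.
rewrite (partition_big (fun x : mindex n => x j) predT) //=.
apply: eq_bigr => a _; rewrite mxE !mulr_sumr; apply: eq_bigr => x /eqP xa.
rewrite !mulr_sumr; apply: eq_bigr => y /andP[/eqP yb _].
by rewrite yb xa /density; field.
Qed.

End TensorAlgebra.

(** * Quadratic bounds for the entropy deficit of a probability vector *)

Section EntropyScalar.
Variable R : realType.
Implicit Types x p q : R.

Lemma ln_leB1 x : 0 < x -> ln x <= x - 1.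
Proof.
move=> x0; have := @le_ln1Dx R (x - 1).
by rewrite subrKC => -> //; rewrite ltrBrDr addNr.
Qed.

Lemma ln_ge1BV x : 0 < x -> 1 - x^-1 <= ln x.
Proof.
move=> x0; have := ln_leB1 (x := x^-1); rewrite invr_gt0 => /(_ x0).
rewrite lnV ?posrE // lerNl; lra.
Qed.

(* [p ln (p / q) >= 2 p (1 - sqrt (q / p))], whence the excess of the relative
   entropy density over its linear part is at least [(sqrt p - sqrt q) ^ 2]. *)
Lemma relative_entropy_ge p q : 0 <= p <= 1 -> 0 < q <= 1 ->
  (p - q) + (p - q) ^+ 2 / 4 <= p * (ln p - ln q).
Proof.
move=> /andP[p0 p1] /andP[q0 q1].
have [->|pn0] := eqVneq p 0; first by rewrite mul0r; nra.
have {}p0 : 0 < p by rewrite lt_def pn0.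
pose s := Num.sqrt p; pose r := Num.sqrt q.
have s0 : 0 < s by rewrite sqrtr_gt0.
have r0 : 0 < r by rewrite sqrtr_gt0.
have ps : p = s ^+ 2 by rewrite sqr_sqrtr // ltW.
have qr : q = r ^+ 2 by rewrite sqr_sqrtr // ltW.
have s1 : s <= 1 by rewrite -sqrtr1 ler_wsqrtr.
have r1 : r <= 1 by rewrite -sqrtr1 ler_wsqrtr.
have h : 2 * (1 - r / s) <= ln p - ln q.
  rewrite ps qr !lnXn // -mulrnBl -[X in _ <= X]mulr_natl ler_pM2l //.
  rewrite -ln_div ?posrE //.
  by have := ln_ge1BV (divr_gt0 s0 r0); rewrite invf_div.
apply: (@le_trans _ _ (p * (2 * (1 - r / s)))); last by rewrite ler_pM2l.
have -> : p * (2 * (1 - r / s)) = 2 * s ^+ 2 - 2 * s * r.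
  by rewrite ps; field; rewrite gt_eqF.
rewrite ps qr.
(* After subtracting [p - q], the goal is that [(s ^+ 2 - r ^+ 2) ^+ 2 / 4] is at most
   [(s - r) ^+ 2], which holds because [s + r <= 2]. *)
have : 0 <= (s - r) ^+ 2 * (4 - (s + r) ^+ 2).
  by rewrite mulr_ge0 ?sqr_ge0 //; nra.
nra.
Qed.

Lemma relative_entropy_le p q : 0 <= p -> 0 < q ->
  p * (ln p - ln q) <= p * (p / q - 1).
Proof.
move=> p0 q0; have [->|pn0] := eqVneq p 0; first by rewrite !mul0r.
have {}p0 : 0 < p by rewrite lt_def pn0.
by rewrite ler_pM2l // -ln_div ?posrE // ln_leB1 // divr_gt0.
Qed.

Variables (m : nat) (p : 'I_m -> R).
Hypotheses (m_gt0 : (0 < m)%N) (p_ge0 : forall a, 0 <= p a)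
  (p_sum : \sum_a p a = 1).

Let q : R := m%:R^-1.

Lemma uniform_gt0 : 0 < q.
Proof. by rewrite invr_gt0 ltr0n. Qed.

Lemma sum_uniform : \sum_(a < m) q = 1.
Proof. by rewrite sumr_const card_ord -mulr_natl divff // pnatr_eq0 -lt0n. Qed.

Lemma distr_le1 a : p a <= 1.
Proof.
rewrite -p_sum (bigD1 a) //= lerDl; apply: sumr_ge0 => b _; exact: p_ge0.
Qed.

Let entropy_gapE : \sum_a p a * (ln (p a) - ln q) =
  ln m%:R + \sum_a p a * ln (p a).
Proof.
under eq_bigr => a _ do rewrite mulrBr.
rewrite sumrB -mulr_suml p_sum mul1r /q lnV ?posrE ?ltr0n //.
by rewrite opprK addrC.
Qed.

(** The deficit is the relative entropy to the uniform distribution. On summation the linear terms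
    [p a - q] cancel and the quadratic ones remain. *)
Lemma shannon_gap_ge :
  (\sum_a (p a - q) ^+ 2) / 4 <= ln m%:R + \sum_a p a * ln (p a).
Proof.
rewrite -entropy_gapE.
apply: (@le_trans _ _ (\sum_a ((p a - q) + (p a - q) ^+ 2 / 4))).
  by rewrite big_split /= sumrB p_sum sum_uniform subrr add0r mulr_suml.
apply: ler_sum => a _; apply: relative_entropy_ge.
  by rewrite p_ge0 distr_le1.
by rewrite uniform_gt0 invf_le1 ?ltr0n // ler1n.
Qed.

(** Relative entropy is bounded by the chi-square divergence, which against the uniform distribution
    is [m] times the squared distance. *)
Lemma shannon_gap_le :
  ln m%:R + \sum_a p a * ln (p a) <= m%:R * \sum_a (p a - q) ^+ 2.
Proof.
have mq : m%:R * q = 1 by rewrite divff // pnatr_eq0 -lt0n.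
rewrite -entropy_gapE.
apply: (@le_trans _ _ (\sum_a p a * (p a / q - 1))).
  by apply: ler_sum => a _; apply: relative_entropy_le; rewrite ?uniform_gt0.
rewrite /q invrK le_eqVlt; apply/orP; left; apply/eqP.
transitivity (\sum_a (m%:R * (p a - q) ^+ 2 + p a - q)).
  by apply: eq_bigr => a _; ring: mq.
by rewrite sumrB big_split /= p_sum sum_uniform mulr_sumr addrK.
Qed.

End EntropyScalar.

(** * Spectral decomposition of marginals *)

Section Marginals.
Variables (R : realType) (k : nat) (n : 'I_k -> nat).
Notation C := R[i].
Implicit Types (A : forall j, 'M[C]_(n j)) (t : tensor R n).

Lemma marginal_hermitian t j :
  (marginal (density t) j)^t* = marginal (density t) j.
Proof.
apply/matrixP => a b; rewrite !mxE rmorph_sum /=.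
under eq_bigr => x _ do rewrite rmorph_sum /=.
rewrite (exchange_big_dep (fun y : mindex n => y j == a)) /=; last first.
  by move=> x y _ /andP[].
apply: eq_bigr => y ya; apply: eq_big => [x|x _].
  rewrite ya /=; congr (_ && _).
  by apply: eq_forallb => i; rewrite [x i == _]eq_sym.
rewrite /density !rmorphM fmorphV /= conjCK -sqnormE conj_real_complex.
by congr (_ / _); rewrite mulrC.
Qed.

Lemma sqnorm_act1 t j (M : 'M[C]_(n j)) : t != 0 ->
  (sqnorm (tensor_act (act1 M) t))%:C%C =
  (sqnorm t)%:C%C * \tr (M^t* *m M *m marginal (density t) j).
Proof.
move=> t0; rewrite sqnorm_act sqnormE -inner_act1 //; congr inner.
apply: eq_tensor_act => i; have [<-|ji] := eqVneq j i; first by rewrite !act1_in.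
by rewrite !act1_out // trmx1 map_mx1 mulmx1.
Qed.

Lemma marginal_trace t j : t != 0 -> \tr (marginal (density t) j) = 1.
Proof.
move=> t0; have := sqnorm_act1 (1%:M : 'M[C]_(n j)) t0.
rewrite trmx1 map_mx1 !mul1mx (eq_tensor_act (B := fun i => 1%:M)); last first.
  by move=> i; have [<-|ji] := eqVneq j i; rewrite ?act1_in ?act1_out.
rewrite tensor_act1 => h; apply/esym.
apply: (mulfI _ (etrans (mulr1 _) h)).
by rewrite (inj_eq (@complexI R)) gt_eqF // sqnorm_gt0.
Qed.

Lemma mxtrace_delta_mul (F : comNzRingType) m (X : 'M[F]_m) (a b : 'I_m) :
  \tr (delta_mx b a *m X) = X a b.
Proof.
rewrite /mxtrace (bigD1 b) //= mxE (bigD1 a) //= mxE !eqxx mul1r.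
rewrite !big1 ?addr0 // => c cb; rewrite ?mxE.
  by rewrite big1 // => d _; rewrite mxE (negbTE cb) mul0r.
by rewrite (negbTE cb) andbF mul0r.
Qed.

(** Entry [(a, b)] is the trace against [delta_mx b a], hence an inner product by [inner_act1];
    there [A] moves to the other side as its adjoint and cancels on every factor except [j]. *)
Lemma marginal_unitary A t j : t != 0 -> (forall i, A i \is unitarymx) ->
  marginal (density (tensor_act A t)) j =
  A j *m marginal (density t) j *m (A j)^t*.
Proof.
move=> t0 uA; set u := tensor_act A t.
have uAV i : (A i)^t* *m A i = 1%:M.
  by rewrite -invmx_unitary // mulVmx // unitarymx_unit.
have nu : sqnorm u = sqnorm t by exact: sqnorm_unitary.
have u0 : u != 0 by rewrite -sqnorm_gt0 nu sqnorm_gt0.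
have nt0 : (sqnorm t)%:C%C != 0 :> C.
  by rewrite (inj_eq (@complexI R)) gt_eqF // sqnorm_gt0.
apply/matrixP => a b.
rewrite -(mxtrace_delta_mul (marginal _ _)) -(mxtrace_delta_mul (_ *m _)).
apply: (mulfI nt0); rewrite -{1}nu sqnormE -inner_act1 // /u.
rewrite inner_act !tensor_actM.
have -> : \tr (delta_mx b a *m (A j *m marginal (density t) j *m (A j)^t*)) =
    \tr ((A j)^t* *m delta_mx b a *m A j *m marginal (density t) j).
  by rewrite !mulmxA mxtrace_mulC !mulmxA.
rewrite sqnormE -inner_act1 //; congr inner; apply: eq_tensor_act => i.
have [<-|ji] := eqVneq j i; first by rewrite !act1_in.
by rewrite !act1_out // mulmx1.
Qed.

(** Reduces entropies of marginals to Shannon entropies of their spectra, where the scalar bounds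
    apply; the factor [ln 2] passes from bits to natural units. *)
Lemma marginal_spectral t j (rho := marginal (density t) j) : t != 0 ->
  exists (P : 'M[C]_(n j)) (p : 'I_(n j) -> R), [/\ P \is unitarymx,
    rho = P^t* *m diag_mx (\row_a (p a)%:C%C) *m P,
    forall a, 0 <= p a, \sum_a p a = 1 &
    ln 2 * entropy rho = - \sum_a p a * ln (p a)].
Proof.
move=> t0; pose P := spectralmx rho; pose d := spectral_diag rho.
have uP : P \is unitarymx := spectral_unitarymx rho.
have hrho : rho \is hermsymmx.
  by apply/is_hermitianmxP; rewrite expr0 scale1r marginal_hermitian.
have rhoE : rho = P^t* *m diag_mx d *m P.
  by rewrite -invmx_unitary //; apply/orthomx_spectralP/hermitian_normalmx.
pose p a : R := complex.Re (d 0 a).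
have dE : d = \row_a (p a)%:C%C.
  apply/rowP => a; rewrite mxE RRe_real //.
  by have /mxOverP := hermitian_spectral_diag_real hrho; apply.
have uPV : P *m P^t* = 1%:M by apply/unitarymxP.
have nt0 : 0 < sqnorm t by rewrite sqnorm_gt0.
exists P, p; split => //; first by rewrite -dE.
(* [p a] times [sqnorm t] is the squared norm of [t] after factor [j] is rotated to the eigenbasis
   and projected to its [a]-th vector, so [p a] is nonnegative. *)
- move=> a; have := sqnorm_act1 (delta_mx a a *m P) t0.
  have -> : \tr ((delta_mx a a *m P)^t* *m (delta_mx a a *m P) *m rho) =
      (p a)%:C%C.
    rewrite rhoE trmx_mul map_mxM /= trmx_delta map_delta_mx !mulmxA.
    rewrite mxtrace_mulC !mulmxA uPV mul1mx mul_delta_mx -!mulmxA.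
    rewrite [P *m (_ *m _)]mulmxA uPV mul1mx.
    by rewrite mxtrace_delta_mul dE !mxE eqxx mulr1n.
  rewrite -real_complexM => /complexI h; rewrite -(pmulr_rge0 _ nt0) -h.
  exact: sqnorm_ge0.
- apply: complexI; rewrite real_complex_sum.
  apply: etrans (marginal_trace j t0); rewrite -/rho rhoE.
  rewrite -mulmxA mxtrace_mulC -mulmxA uPV mulmx1 mxtrace_diag.
  by apply: eq_bigr => a _; rewrite dE mxE.
rewrite /entropy /log2mx -/P -/d mulrN; congr (- _).
rewrite {1}rhoE invmx_unitary // -!mulmxA [P *m (_ *m _)]mulmxA uPV mul1mx.
rewrite mxtrace_mulC -!mulmxA uPV mulmx1 mulmx_diag mxtrace_diag.
rewrite (_ : \sum_i _ = (\sum_a p a * log2 (p a))%:C%C); last first.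
  rewrite real_complex_sum; apply: eq_bigr => a _.
  by rewrite !mxE dE !mxE /= (real_complexM (p a)).
rewrite /= mulr_sumr; apply: eq_bigr => a _; rewrite /log2 mulrCA; congr (_ * _).
by rewrite mulrC divfK // gt_eqF // ln_gt0 // ltr1n.
Qed.

End Marginals.

(** * Entropy deficit of a marginal against its distance from uniform *)

Section EntropyGap.
Variables (R : realType) (k : nat) (n : 'I_k -> nat).
Notation C := R[i].
Implicit Types (t : tensor R n).

(** The squared Hilbert-Schmidt distance to the maximally mixed state. It replaces the entropy in
    limit arguments, being polynomial in the real and imaginary parts of the entries of the
    marginal. *)
Definition marginal_defect t j : R :=
  \sum_a \sum_b
    normsq ((marginal (density t) j - ((n j)%:R^-1)%:C%C%:M) a b).

Lemma sum_normsq_mx m (X : 'M[C]_m) :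
  (\sum_a \sum_b normsq (X a b))%:C%C = \tr (X *m X^t*).
Proof.
rewrite real_complex_sum; apply: eq_bigr => a _.
rewrite real_complex_sum mxE; apply: eq_bigr => b _.
by rewrite normsqE !mxE.
Qed.

(** Unitary invariance of the Hilbert-Schmidt norm: the scalar matrix is diagonal in the eigenbasis
    too, so only the differences [p a - c] contribute. *)
Lemma sum_normsq_spectral m (P : 'M[C]_m) (p : 'I_m -> R) (c : R) :
  P \is unitarymx ->
  \sum_a \sum_b
    normsq ((P^t* *m diag_mx (\row_a (p a)%:C%C) *m P - c%:C%C%:M) a b) =
  \sum_a (p a - c) ^+ 2.
Proof.
move=> uP; have uPV : P *m P^t* = 1%:M by apply/unitarymxP.
have uVP : P^t* *m P = 1%:M.
  by rewrite -invmx_unitary // mulVmx // unitarymx_unit.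
apply: complexI; rewrite sum_normsq_mx.
set D := diag_mx (\row_a (p a - c)%:C%C : 'rV[C]_m).
have -> : P^t* *m diag_mx (\row_a (p a)%:C%C) *m P - c%:C%C%:M = P^t* *m D *m P.
  have -> : D = diag_mx (\row_a (p a)%:C%C) - c%:C%C%:M.
    by apply/matrixP => a b; rewrite !mxE rmorphB mulrnBl.
  by rewrite mulmxBr mulmxBl mul_mx_scalar -scalemxAl uVP scalemx1.
rewrite !trmx_mul !map_mxM /= trmxCK tr_diag_mx map_diag_mx.
rewrite -!mulmxA mxtrace_mulC -!mulmxA uPV mulmx1 [P *m _]mulmxA uPV mul1mx.
rewrite mulmx_diag mxtrace_diag real_complex_sum; apply: eq_bigr => a _.
by rewrite !mxE /= conj_real_complex -real_complexM expr2.
Qed.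

Variables (t : tensor R n) (j : 'I_k).
Hypotheses (t_neq0 : t != 0) (n_gt0 : (0 < n j)%N).
Let rho := marginal (density t) j.

Let ln2_gt0 : 0 < ln 2 :> R.
Proof. by rewrite ln_gt0 // ltr1n. Qed.

(** This bound turns nearly maximal entropies into small defects, for the existence of a mixed
    state; [entropy_gap_le] goes the other way, for computing [E_lower]. *)
Lemma entropy_gap_ge : marginal_defect t j / 4 <= ln (n j)%:R - ln 2 * entropy rho.
Proof.
have [P [p [uP rhoE p0 p1 ->]]] := marginal_spectral j t_neq0.
rewrite /marginal_defect rhoE sum_normsq_spectral // opprK.
exact: shannon_gap_ge.
Qed.

Lemma entropy_gap_le :
  ln (n j)%:R - ln 2 * entropy rho <= (n j)%:R * marginal_defect t j.
Proof.
have [P [p [uP rhoE p0 p1 ->]]] := marginal_spectral j t_neq0.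
rewrite /marginal_defect rhoE sum_normsq_spectral // opprK.
exact: shannon_gap_le.
Qed.

Lemma marginal_defect_ge0 : 0 <= marginal_defect t j.
Proof.
by apply: sumr_ge0 => a _; apply: sumr_ge0 => b _; exact: normsq_ge0.
Qed.

Lemma entropy_le : entropy rho <= log2 (n j)%:R.
Proof.
rewrite ler_pdivlMr // mulrC -subr_ge0; apply: le_trans entropy_gap_ge.
by rewrite divr_ge0 // marginal_defect_ge0.
Qed.

Lemma entropy_maxP : entropy rho = log2 (n j)%:R <-> marginal_defect t j = 0.
Proof.
have l2 : ln 2 != 0 :> R by rewrite gt_eqF.
split=> [h|h].
  apply/eqP; rewrite eq_le marginal_defect_ge0 andbT.
  have := entropy_gap_ge; rewrite h /log2 [ln 2 * _]mulrC divfK // subrr.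
  by rewrite pmulr_lle0 ?invr_gt0.
apply/eqP; rewrite eq_le entropy_le ler_pdivrMr // mulrC -subr_le0.
by rewrite (le_trans entropy_gap_le) // h mulr0.
Qed.

Lemma marginal_defect_eq0 : marginal_defect t j = 0 ->
  rho = ((n j)%:R^-1)%:C%C%:M.
Proof.
move=> /eqP; rewrite psumr_eq0 => [/allP h|a _]; last first.
  by apply: sumr_ge0 => b _; exact: normsq_ge0.
apply/eqP; rewrite -subr_eq0; apply/eqP/matrixP => a b; rewrite [RHS]mxE.
have /= := h a (mem_index_enum _).
rewrite psumr_eq0 => [/allP/(_ b (mem_index_enum _))|c _]; last exact: normsq_ge0.
by rewrite /= normsq_eq0 => /eqP.
Qed.

End EntropyGap.

(** * Capacity, unstable supports and the null cone *)

Section Capacity.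
Variables (R : realType) (k : nat) (n : 'I_k -> nat).
Hypothesis n_gt0 : forall j, (0 < n j)%N.
Notation C := R[i].
Implicit Types (A V : forall j, 'M[C]_(n j)) (t psi : tensor R n).
Implicit Types (lam : forall j, 'I_(n j) -> R).

(** The factor [(n j)%:R^-1] compensates the degree [n j] of the determinant. *)
Definition logdet A : R := \sum_j (n j)%:R^-1 * ln (normsq (\det (A j))).

(* Unlike [sqnorm (tensor_act A t)], this is invariant under rescaling [A],
   so that no restriction to matrices of determinant 1 is needed. *)
Definition capfun A t : R := sqnorm (tensor_act A t) * expR (- logdet A).

(** The diagonal matrices with entries [expR (lam j a)] multiply the basis vector [x] by
    [expR (weight lam x)]; they have determinant 1 when [lam] is traceless. *)
Definition weight lam (x : mindex n) : R := \sum_j lam j (x j).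

Definition traceless lam := forall j, \sum_a lam j a = 0.

Lemma normsq_det_gt0 m (M : 'M[C]_m) : M \in unitmx -> 0 < normsq (\det M).
Proof. by rewrite unitmxE unitfE normsq_gt0. Qed.

Lemma logdetM A V : (forall j, A j \in unitmx) -> (forall j, V j \in unitmx) ->
  logdet (fun j => A j *m V j) = logdet A + logdet V.
Proof.
move=> uA uV; rewrite /logdet -big_split /=; apply: eq_bigr => j _.
by rewrite det_mulmx normsqM lnM ?posrE ?normsq_det_gt0 // mulrDr.
Qed.

Lemma normsq_det_unitary m (P : 'M[C]_m) : P \is unitarymx ->
  normsq (\det P) = 1.
Proof.
move=> /unitarymxP/(congr1 determinant); rewrite det_mulmx det_map_mx det_tr det1.
by move=> h; apply: complexI; rewrite normsqE h.
Qed.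

(** Each [d a] is the squared norm of a column of [M] times the adjoint of [P], hence nonnegative;
    it is nonzero because the product of all [d a] is. *)
Lemma gram_spectral m (M : 'M[C]_m) : M \in unitmx ->
  exists (P : 'M[C]_m) (d : 'I_m -> R), [/\ P \is unitarymx,
    M^t* *m M = P^t* *m diag_mx (\row_a (d a)%:C%C) *m P,
    forall a, 0 < d a & \prod_a d a = normsq (\det M)].
Proof.
move=> uM; set G := M^t* *m M.
have hG : G \is hermsymmx.
  by apply/is_hermitianmxP; rewrite expr0 scale1r trmx_mul map_mxM trmxCK.
pose P := spectralmx G; pose d a : R := complex.Re (spectral_diag G 0 a).
have uP : P \is unitarymx := spectral_unitarymx G.
have uPV : P *m P^t* = 1%:M by apply/unitarymxP.
have dE : spectral_diag G = \row_a (d a)%:C%C.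
  apply/rowP => a; rewrite mxE RRe_real //.
  by have /mxOverP := hermitian_spectral_diag_real hG; apply.
have GE : G = P^t* *m diag_mx (\row_a (d a)%:C%C) *m P.
  by rewrite -invmx_unitary // -dE; apply/orthomx_spectralP/hermitian_normalmx.
have d0 a : 0 <= d a.
  have : (d a)%:C%C = (P *m G *m P^t*) a a.
    rewrite GE !mulmxA uPV mul1mx -mulmxA uPV mulmx1.
    by rewrite !mxE eqxx mulr1n.
  have -> : P *m G *m P^t* = (M *m P^t*)^t* *m (M *m P^t*).
    by rewrite trmx_mul map_mxM trmxCK !mulmxA.
  move=> h.
  rewrite -ler0c h mxE; apply: sumr_ge0 => b _.
  by rewrite !mxE mulrC -normCK exprn_ge0.
have dp : \prod_a d a = normsq (\det M).
  apply: complexI; rewrite normsqE' real_complex_prod.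
  transitivity (\det G); last by rewrite det_mulmx det_map_mx det_tr.
  rewrite GE !det_mulmx det_diag mulrC mulrA -det_mulmx uPV det1.
  by rewrite mul1r; apply: eq_bigr => a _; rewrite mxE.
exists P, d; split => // a; rewrite lt_def d0 andbT.
have : \prod_a d a != 0 by rewrite dp gt_eqF // normsq_det_gt0.
by move/prodf_neq0; apply.
Qed.

Lemma sum_ln (I : finType) (d : I -> R) : (forall a, 0 < d a) ->
  \sum_a ln (d a) = ln (\prod_a d a).
Proof.
move=> d0; rewrite -[LHS]expRK expR_sum; congr ln.
by apply: eq_bigr => a _; rewrite lnK // posrE.
Qed.

(** The norm of [tensor_act A t] depends only on the Gram matrices of the [A j], which unitaries
    [V j] diagonalise. Dividing their eigenvalues by the geometric mean makes the logarithms
    traceless and absorbs the factor [expR (- logdet A)]. *)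
Lemma capfun_spectral A : (forall j, A j \in unitmx) ->
  exists V lam, [/\ forall j, V j \is unitarymx, traceless lam &
    forall t, capfun A t =
      \sum_x expR (weight lam x) * normsq (tensor_act V t x)].
Proof.
move=> uA; have H j := gram_spectral (uA j).
pose V j := projT1 (cid (H j)); pose d j := projT1 (cid (projT2 (cid (H j)))).
have Hd j := projT2 (cid (projT2 (cid (H j)))); rewrite -/(V _) -/(d _) in Hd.
pose lam j a := ln (d j a) - (n j)%:R^-1 * ln (normsq (\det (A j))).
have d0 j a : 0 < d j a by case: (Hd j) => _ _ + _; apply.
have dp j : \sum_a ln (d j a) = ln (normsq (\det (A j))).
  by rewrite sum_ln //; case: (Hd j) => _ _ _ ->.
exists V, lam; split=> [j|j|t]; first by case: (Hd j).
  rewrite sumrB dp sumr_const card_ord -[X in _ - X]mulr_natl mulrA divff ?mul1r ?subrr //.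
  by rewrite pnatr_eq0 -lt0n.
rewrite /capfun; have -> : sqnorm (tensor_act A t) =
    \sum_(x : mindex n) (\prod_j d j (x j)) * normsq (tensor_act V t x).
  apply: complexI; rewrite sqnorm_act.
  have -> : tensor_act (fun j => (A j)^t* *m A j) t = tensor_act
      (fun j => (V j)^t*) (tensor_act (fun j => diag_mx (\row_a (d j a)%:C%C))
        (tensor_act V t)).
    by rewrite !tensor_actM; apply: eq_tensor_act => j; case: (Hd j).
  rewrite -inner_act real_complex_sum; apply: eq_bigr => x _.
  rewrite tensor_act_diag real_complexM normsqE' real_complex_prod mulrCA.
  by congr (_ * _); apply: eq_bigr => j _; rewrite mxE.
rewrite mulr_suml; apply: eq_bigr => x _; rewrite mulrAC; congr (_ * _).
rewrite /weight sumrB expRD; congr (_ * expR _).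
by rewrite expR_sum; apply: eq_bigr => j _; rewrite lnK // posrE.
Qed.

(** A tensor supported on such a set tends to 0 under the one-parameter group generated by [lam]. *)
Definition unstable (S : {set mindex n}) :=
  exists2 lam, traceless lam & forall x, x \in S -> weight lam x < 0.

Definition mixed psi := sqnorm psi = 1 /\
  forall j, marginal (density psi) j = ((n j)%:R^-1)%:C%C%:M.

Lemma sqnorm1_neq0 psi : sqnorm psi = 1 -> psi != 0.
Proof. by move=> h; rewrite -sqnorm_gt0 h ltr01. Qed.

Lemma mixed_unitary V psi : (forall j, V j \is unitarymx) -> mixed psi ->
  mixed (tensor_act V psi).
Proof.
move=> uV [psi1 mpsi]; split; first by rewrite sqnorm_unitary.
move=> j; rewrite marginal_unitary ?sqnorm1_neq0 // mpsi.
rewrite mul_mx_scalar -scalemxAl.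
by have /unitarymxP -> := uV j; rewrite scalemx1.
Qed.

Lemma mixed_slice psi j (a : 'I_(n j)) : mixed psi ->
  \sum_(x : mindex n | x j == a) normsq (psi x) = (n j)%:R^-1.
Proof.
move=> [psi1 /(_ j) /matrixP /(_ a a)]; rewrite !mxE eqxx mulr1n => h.
apply: complexI; rewrite -h real_complex_sum; apply: eq_bigr => x xa.
rewrite (big_pred1 x) => [|y].
  by rewrite /density -sqnormE psi1 divr1 normsqE.
apply/andP/eqP => [[/eqP ya /forall_inP xy]|->]; last first.
  by split=> //; apply/forall_inP.
apply/ffunP => i; have [->|ij] := eqVneq i j; first by rewrite ya (eqP xa).
by rewrite (eqP (xy i ij)).
Qed.

(** The squared moduli of [psi] form a distribution on multi-indices in which each coordinate is
    uniform, so the mean weight is a sum of averages of the [lam j]. *)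
Lemma mixed_weight psi lam : mixed psi -> traceless lam ->
  \sum_x normsq (psi x) * weight lam x = 0.
Proof.
move=> mpsi tlam; rewrite /weight.
under eq_bigr => x _ do rewrite mulr_sumr.
rewrite exchange_big /=; apply: big1 => j _.
rewrite (partition_big (fun x : mindex n => x j) predT) //=.
transitivity (\sum_a (n j)%:R^-1 * lam j a); last by rewrite -mulr_sumr tlam mulr0.
apply: eq_bigr => a _; rewrite -(mixed_slice a mpsi) mulr_suml.
by apply: eq_bigr => x /eqP ->.
Qed.

(** The mean weight is zero while weights are at most [- g] on [S] and at most [L] off it; hence the
    mass off [S] is at least [g / (g + L)]. *)
Lemma unstable_gap S : unstable S -> exists2 c : R, 0 < c &
  forall psi, mixed psi -> c <= \sum_(x | x \notin S) normsq (psi x).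
Proof.
move=> [lam tlam lamS].
(* The initial value 1 keeps [g] positive when [S] is empty. *)
pose g := \big[Num.min/1]_(x in S) (- weight lam x).
pose L := \sum_x `|weight lam x|.
have g0 : 0 < g.
  rewrite /g; elim/big_ind: _ => //; first by move=> x y; rewrite lt_min => -> ->.
  by move=> x /lamS; rewrite oppr_gt0.
have L0 : 0 <= L by exact: sumr_ge0.
have gL : 0 < g + L by rewrite ltr_pwDl.
exists (g / (g + L)); first by rewrite divr_gt0.
move=> psi mpsi; rewrite ler_pdivrMr //.
have := mixed_weight mpsi tlam; have := mpsi.1; rewrite /sqnorm.
rewrite (bigID (mem S)) /= => h1; rewrite (bigID (mem S)) /= => h2.
set wC := \sum_(x | x \notin S) normsq (psi x) in h1 *.
set wS := \sum_(x in S) normsq (psi x) in h1.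
have hS : \sum_(x in S) normsq (psi x) * weight lam x <= - (g * wS).
  rewrite /wS mulr_sumr -sumrN; apply: ler_sum => x xS.
  rewrite mulrC -mulNr ler_wpM2r ?normsq_ge0 // lerNr.
  by rewrite /g (bigD1 x) //= ge_min lexx.
have hC : \sum_(x | x \notin S) normsq (psi x) * weight lam x <= L * wC.
  rewrite /wC mulr_sumr; apply: ler_sum => x xS.
  rewrite mulrC ler_wpM2r ?normsq_ge0 // (le_trans (ler_norm _)) //.
  by rewrite /L (bigD1 x) //= lerDl sumr_ge0.
have wSE : g * wS = g - g * wC by rewrite (_ : wS = 1 - wC) ?mulrBr ?mulr1 // -h1 addrK.
have := lerD hS hC; rewrite h2 wSE mulrDr; lra.
Qed.

(** In [capfun_near_mixed] the set [S] varies with [A], so a bound common to all [S] is needed;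
    there are finitely many of them. *)
Lemma unstable_gap_uniform : exists2 c : R, 0 < c &
  forall S psi, unstable S -> mixed psi ->
    c <= \sum_(x | x \notin S) normsq (psi x).
Proof.
have H S : exists c : R, 0 < c /\ (unstable S -> forall psi, mixed psi ->
    c <= \sum_(x | x \notin S) normsq (psi x)).
  have [uS|nS] := pselect (unstable S); last by exists 1; split.
  by have [c c0 hc] := unstable_gap uS; exists c.
have [c hc] := boolp.choice H.
exists (\big[Num.min/1]_S c S).
  elim/big_ind: _ => //; first by move=> x y; rewrite lt_min => -> ->.
  by move=> S _; case: (hc S).
move=> S psi uS mpsi; apply: le_trans ((hc S).2 uS psi mpsi).
by rewrite (bigD1 S) //= ge_min lexx.
Qed.

(** In the frame [V] the coordinates of nonnegative weight are not shrunk. On them the rotated mixed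
    state has mass at least [c], so a tensor within squared distance [c / 4] has mass at least
    [c / 4]. *)
Lemma capfun_near_mixed psi : mixed psi -> exists2 c : R, 0 < c &
  forall t A, sqnorm (psi - t) <= c -> (forall j, A j \in unitmx) ->
    c <= capfun A t.
Proof.
move=> mpsi; have [c c0 hc] := unstable_gap_uniform.
exists (c / 4); first by rewrite divr_gt0.
move=> t A tpsi uA; have [V [lam [uV tlam ->]]] := capfun_spectral uA.
pose S : {set mindex n} := [set x | weight lam x < 0]%SET.
have uS : unstable S by exists lam => // x; rewrite inE.
have := hc S _ uS (mixed_unitary uV mpsi).
have -> : tensor_act V psi = tensor_act V (psi - t) + tensor_act V t.
  by rewrite tensor_actB subrK.
move=> h1.
have h2 : \sum_(x | x \notin S) normsq ((tensor_act V (psi - t) + tensor_act V t) x)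
    <= 2 * \sum_x normsq (tensor_act V (psi - t) x) +
       2 * \sum_(x | x \notin S) normsq (tensor_act V t x).
  apply: (@le_trans _ _ (2 * \sum_(x | x \notin S) normsq (tensor_act V (psi - t) x)
      + 2 * \sum_(x | x \notin S) normsq (tensor_act V t x))).
    rewrite !mulr_sumr -big_split /=; apply: ler_sum => x _.
    by rewrite [X in normsq X]ffunE normsqD_le.
  rewrite lerD2r ler_pM2l // [leRHS](bigID (mem S)) /= lerDr sumr_ge0 // => x _.
  exact: normsq_ge0.
have h3 : \sum_(x | x \notin S) normsq (tensor_act V t x) <=
    \sum_x expR (weight lam x) * normsq (tensor_act V t x).
  rewrite [leRHS](bigID (mem S)) /=.
  apply: (@le_trans _ _ (\sum_(x | x \notin S)
      expR (weight lam x) * normsq (tensor_act V t x))).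
    apply: ler_sum => x; rewrite inE -leNgt => wx.
    by rewrite ler_peMl ?normsq_ge0 // -expR0 ler_expR.
  by rewrite lerDr sumr_ge0 // => x _; rewrite mulr_ge0 ?expR_ge0 ?normsq_ge0.
have h4 : \sum_x normsq (tensor_act V (psi - t) x) <= c / 4.
  by rewrite -/(sqnorm _) sqnorm_unitary.
lra.
Qed.

(* The tensors destabilised by some torus: the algebraic form of the
   null cone given by the Hilbert-Mumford criterion. *)
Definition null t := exists2 S, unstable S &
  exists2 A : forall j, 'M[C]_(n j), (forall j, A j \in unitmx) &
    forall x, x \notin S -> tensor_act A t x = 0.

(** Composing [A] with the diagonal matrices [expR (s * lam j a)] leaves [logdet] unchanged and
    scales the squared norm by at most [expR (- (2 * s * g))]. *)
Lemma null_capfun t (e : R) : 0 < e -> null t ->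
  exists2 A : forall j, 'M[C]_(n j), (forall j, A j \in unitmx) & capfun A t < e.
Proof.
move=> e0 [S [lam tlam lamS] [A uA At0]].
pose g := \big[Num.min/1]_(x in S) (- weight lam x).
have g0 : 0 < g.
  rewrite /g; elim/big_ind: _ => //; first by move=> x y; rewrite lt_min => -> ->.
  by move=> x /lamS; rewrite oppr_gt0.
(* With [s * g = K] the new value is at most [e * K * expR (- (2 * K))], which is below [e] since
   [K < 1 + 2 * K <= expR (2 * K)]. *)
pose K := capfun A t / e.
have K0 : 0 <= K by rewrite divr_ge0 ?(ltW e0) // /capfun mulr_ge0 ?sqnorm_ge0 ?expR_ge0.
pose s := K / g.
have s0 : 0 <= s by rewrite divr_ge0 // ltW.
pose D j : 'M[C]_(n j) := diag_mx (\row_a (expR (s * lam j a))%:C%C).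
have detD j : \det (D j) = 1.
  rewrite det_diag; under eq_bigr => a _ do rewrite mxE.
  by rewrite -real_complex_prod -expR_sum -mulr_sumr tlam mulr0 expR0.
have uD j : D j \in unitmx by rewrite unitmxE detD unitr1.
exists (fun j => D j *m A j) => [j|]; first by rewrite unitmx_mul uD uA.
have normsq1 : normsq (1 : C) = 1 by rewrite /normsq /= expr0n addr0 expr1n.
have lD : logdet D = 0.
  by rewrite /logdet big1 // => j _; rewrite detD normsq1 ln1 mulr0.
rewrite /capfun logdetM // lD add0r -tensor_actM.
have h : sqnorm (tensor_act D (tensor_act A t)) <=
    expR (- (2 * K)) * sqnorm (tensor_act A t).
  rewrite mulr_sumr; apply: ler_sum => x _; rewrite tensor_act_diag normsqM.
  have [xS|/At0 ->] := boolP (x \in S); last by rewrite (eqP (_ : normsq 0 == 0)) ?mulr0 ?normsq_eq0.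
  rewrite ler_wpM2r ?normsq_ge0 //.
  under eq_bigr => j _ do rewrite mxE.
  rewrite -real_complex_prod -expR_sum normsqC -mulr_sumr -/(weight lam x).
  rewrite -expRM_natl ler_expR; suff : K <= s * - weight lam x by rewrite mulrN; lra.
  rewrite (_ : K = s * g) ?ler_wpM2l //; last by rewrite divfK // gt_eqF.
  by rewrite /g (bigD1 x) //= ge_min lexx.
apply: (@le_lt_trans _ _ (expR (- (2 * K)) * capfun A t)).
  by rewrite /capfun mulrA ler_wpM2r ?expR_ge0.
have -> : capfun A t = e * K by rewrite mulrCA divff ?mulr1 // gt_eqF.
rewrite mulrCA -[ltRHS]mulr1 ltr_pM2l // expRN mulrC ltr_pdivrMr ?expR_gt0 //.
rewrite mul1r; apply: lt_le_trans (expR_ge1Dx _); lra.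
Qed.

(** When [capfun A t] is small, so are the coordinates of nonnegative weight in the frame [V], their
    factors being at least 1. Deleting them leaves a tensor in [null]. *)
Lemma null_near t (e : R) : 0 < e ->
  (forall d : R, 0 < d -> exists2 A : forall j, 'M[C]_(n j),
    (forall j, A j \in unitmx) & capfun A t < d) ->
  exists2 t', null t' & sqnorm (t - t') < e.
Proof.
move=> e0 H; have [A uA] := H e e0.
have [V [lam [uV tlam ->]]] := capfun_spectral uA => small.
pose S : {set mindex n} := [set x | weight lam x < 0]%SET.
have uS : unstable S by exists lam => // x; rewrite inE.
have uV' j : V j \in unitmx by exact: unitarymx_unit.
pose w : tensor R n := [ffun x => if x \in S then tensor_act V t x else 0].
pose t' := tensor_act (fun j => invmx (V j)) w.
have Vt' : tensor_act V t' = w.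
  rewrite tensor_actM (eq_tensor_act (B := fun j => 1%:M)) ?tensor_act1 //.
  by move=> j; rewrite mulmxV.
exists t'.
  by exists S => //; exists V => // x /negbTE xS; rewrite Vt' ffunE xS.
apply: le_lt_trans small; rewrite -(sqnorm_unitary _ uV) tensor_actB Vt'.
apply: ler_sum => x _; rewrite !ffunE inE; case: ltP => wx.
  by rewrite subrr (eqP (_ : normsq 0 == 0)) ?normsq_eq0 ?mulr_ge0 ?expR_ge0 ?normsq_ge0.
by rewrite subr0 ler_peMl ?normsq_ge0 // -expR0 ler_expR.
Qed.

End Capacity.

(** * One gradient step on a spectrum *)

Section Perturbation.
Variables (R : realType) (m : nat) (p : 'I_m -> R).
Hypotheses (m_gt0 : (0 < m)%N) (p_ge0 : forall a, 0 <= p a)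
  (p_sum : \sum_a p a = 1).
Let q : R := m%:R^-1.
Let D := \sum_a (p a - q) ^+ 2.

(** A descent step of length 1/4 from [u = 1] for [ln (\sum_a u a * p a) - q * \sum_a ln (u a)],
    whose gradient there is [p - q]. *)
Definition gradient_step a : R := 1 - (p a - q) / 4.

Let p_bounds a : [/\ 0 <= p a, p a <= 1, 0 < q & q <= 1].
Proof.
split; [exact: p_ge0|exact: distr_le1|exact: uniform_gt0|].
by rewrite invf_le1 ?ltr0n // ler1n.
Qed.

Lemma gradient_step_gt0 a : 0 < gradient_step a.
Proof. by rewrite /gradient_step; have [] := p_bounds a; lra. Qed.

Lemma gradient_step_mean : \sum_a gradient_step a * p a = 1 - D / 4.
Proof.
transitivity (\sum_a (p a - (p a - q) ^+ 2 / 4 - q / 4 * (p a - q))).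
  by apply: eq_bigr => a _; rewrite /gradient_step; field.
rewrite !sumrB -mulr_sumr -mulr_suml p_sum sumrB p_sum sum_uniform //.
by rewrite subrr mulr0 subr0.
Qed.

(** The price paid in the determinant is at most half of the gain [D / 4] of [gradient_step_mean],
    so the capacity decreases. *)
Lemma gradient_step_ln : - (q * \sum_a ln (gradient_step a)) <= D / 8.
Proof.
have h a : - ln (gradient_step a) <= (p a - q) / 4 + (p a - q) ^+ 2 / 8.
  have u0 := gradient_step_gt0 a.
  have := ln_ge1BV u0; suff : (gradient_step a)^-1 - 1 <=
    (p a - q) / 4 + (p a - q) ^+ 2 / 8 by lra.
  rewrite lerBlDr -div1r ler_pdivrMr // /gradient_step.
  have [] := p_bounds a; move: (p a) => x x0 x1 q0 q1.
  (* With [y = (x - q) / 4] the goal reads [1 <= (1 + y + 2 * y ^+ 2) * (1 - y)], that is,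
     [0 <= y ^+ 2 * (1 - 2 * y)]. *)
  have : 0 <= (x - q) ^+ 2 * (1 - (x - q) / 2).
    by rewrite mulr_ge0 ?sqr_ge0 //; lra.
  nra.
rewrite -mulrN -sumrN.
have q0 : 0 < q by exact: uniform_gt0.
apply: (@le_trans _ _ (q * \sum_a ((p a - q) / 4 + (p a - q) ^+ 2 / 8))).
  by rewrite ler_pM2l //; apply: ler_sum.
rewrite big_split /= -!mulr_suml sumrB p_sum sum_uniform // subrr mul0r add0r.
rewrite ler_piMl //; last by rewrite invf_le1 ?ltr0n // ler1n.
by rewrite divr_ge0 // sumr_ge0 // => a _; exact: sqr_ge0.
Qed.

End Perturbation.

(** * Positive capacity forces maximal [E_lower] *)

Section Scaling.
Variables (R : realType) (k : nat) (n : 'I_k -> nat).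
Hypothesis n_gt0 : forall j, (0 < n j)%N.
Notation C := R[i].
Implicit Types (A V : forall j, 'M[C]_(n j)) (t psi : tensor R n).

Lemma tensor_act_neq0 A t : (forall j, A j \in unitmx) -> t != 0 ->
  tensor_act A t != 0.
Proof.
move=> uA; apply: contraNN => /eqP At0; rewrite -(tensor_actVK t uA) At0.
by apply/eqP/ffunP => x; rewrite !ffunE big1 // => y _; rewrite ffunE mulr0.
Qed.

Lemma capfun_gt0 A t : (forall j, A j \in unitmx) -> t != 0 -> 0 < capfun A t.
Proof.
by move=> uA t0; rewrite mulr_gt0 ?expR_gt0 // sqnorm_gt0 tensor_act_neq0.
Qed.

Lemma logdet_act1 j (M : 'M[C]_(n j)) :
  logdet (act1 M) = (n j)%:R^-1 * ln (normsq (\det M)).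
Proof.
rewrite /logdet (bigD1 j) //= act1_in big1 ?addr0 // => i ij.
rewrite act1_out 1?eq_sym // det1.
by rewrite (_ : normsq 1 = 1) ?ln1 ?mulr0 // /normsq /= expr0n addr0 expr1n.
Qed.

(* If a marginal is far from uniform, rescaling the corresponding factor along
   the gradient of the capacity decreases the latter by a definite factor. *)
Lemma defect_near_min t A (c e : R) j : 0 < c -> t != 0 ->
  (forall B : forall j, 'M[C]_(n j), (forall j, B j \in unitmx) ->
    c <= capfun B t) ->
  (forall j, A j \in unitmx) -> capfun A t <= c * expR e ->
  marginal_defect (tensor_act A t) j <= 8 * e.
Proof.
move=> c0 t0 hc uA hA; set v := tensor_act A t.
have v0 : v != 0 by exact: tensor_act_neq0.
have [P [p [uP rhoE p0 p1 _]]] := marginal_spectral j v0.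
rewrite /marginal_defect rhoE sum_normsq_spectral //.
set D := \sum_a _.
have uPV : P *m P^t* = 1%:M by apply/unitarymxP.
pose u := gradient_step p.
have u0 a : 0 < u a by exact: gradient_step_gt0.
(* Square roots, so that the Gram matrix of [M] has spectrum [u] in the eigenbasis of the
   marginal. *)
pose W : 'M[C]_(n j) := diag_mx (\row_a (Num.sqrt (u a))%:C%C).
pose M := W *m P.
have detW : normsq (\det W) = \prod_a u a.
  rewrite det_diag (_ : \prod_i _ = (\prod_a Num.sqrt (u a))%:C%C); last first.
    by rewrite real_complex_prod; apply: eq_bigr => a _; rewrite mxE.
  rewrite normsqC -prodrXl; apply: eq_bigr => a _.
  by rewrite sqr_sqrtr // ltW.
have detM : normsq (\det M) = \prod_a u a.
  by rewrite det_mulmx normsqM detW normsq_det_unitary // mulr1.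
have uM : M \in unitmx.
  rewrite unitmxE unitfE -normsq_eq0 detM gt_eqF //.
  exact: prodr_gt0.
have uM1 i : act1 M i \in unitmx.
  by have [<-|ji] := eqVneq j i; rewrite ?act1_in // act1_out // unitmx1.
have trM : \tr (M^t* *m M *m marginal (density v) j) = (1 - D / 4)%:C%C.
  rewrite -(gradient_step_mean _ p1) // real_complex_sum rhoE.
  rewrite trmx_mul map_mxM /= -!mulmxA mxtrace_mulC -!mulmxA.
  rewrite uPV mulmx1 [P *m (_ *m _)]mulmxA uPV mul1mx.
  rewrite tr_diag_mx map_diag_mx !mulmx_diag mxtrace_diag.
  apply: eq_bigr => a _; rewrite !mxE /= conj_real_complex -!real_complexM.
  by rewrite mulrA -expr2 sqr_sqrtr // ltW.
have := hc (fun i => act1 M i *m A i); rewrite /capfun logdetM // -tensor_actM.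
rewrite -/v logdet_act1 detM -sum_ln // opprD expRD.
have -> : sqnorm (tensor_act (act1 M) v) = sqnorm v * (1 - D / 4).
  by apply: complexI; rewrite sqnorm_act1 // trM -real_complexM.
have h1 : 1 - D / 4 <= expR (- (D / 4)) by exact: expR_ge1Dx.
have h2 : expR (- ((n j)%:R^-1 * \sum_a ln (u a))) <= expR (D / 8).
  by rewrite ler_expR gradient_step_ln.
set E := expR (- (_ * _)) in h2 *; set F := expR (- logdet A).
(* The norm contributes [expR (- (D / 4))] and the determinant [expR (D / 8)]; with
   [capfun A t <= c * expR e] this yields [D / 8 <= e]. *)
move=> h; have {}h : c <= capfun A t * expR (- (D / 8)).
  apply: le_trans (h _) _; first by move=> i; rewrite unitmx_mul uM1 uA.
  rewrite (_ : _ * (E * F) = capfun A t * ((1 - D / 4) * E)); last first.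
    by rewrite /capfun -/v -/F; ring.
  rewrite ler_pM2l ?capfun_gt0 //.
  rewrite (_ : - (D / 8) = - (D / 4) + D / 8); last by field.
  rewrite expRD; apply: (@le_trans _ _ (expR (- (D / 4)) * E)).
    by rewrite ler_wpM2r ?expR_ge0.
  by rewrite ler_wpM2l ?expR_ge0.
have : c <= c * expR (e - D / 8).
  apply: (le_trans h); rewrite expRD mulrA ler_wpM2r ?expR_ge0 //.
rewrite -{1}[c]mulr1 ler_pM2l // -[X in X <= _]expR0 ler_expR; lra.
Qed.

Lemma entropy_theta_le (theta : 'I_k -> R) t : (forall j, 0 <= theta j) ->
  t != 0 -> entropy_theta theta t <= \sum_j theta j * log2 (n j)%:R.
Proof.
move=> th0 t0; apply: ler_sum => j _.
by rewrite ler_wpM2l // entropy_le.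
Qed.

(** Near-minimisers of the capacity have small defects by [defect_near_min], hence entropies close
    to the upper bound. *)
Lemma E_lower_max (theta : 'I_k -> R) t (c : R) : (forall j, 0 <= theta j) ->
  t != 0 -> 0 < c ->
  (forall A : forall j, 'M[C]_(n j), (forall j, A j \in unitmx) ->
    c <= capfun A t) ->
  E_lower theta t = \sum_j theta j * log2 (n j)%:R.
Proof.
move=> th0 t0 c0 hc; set H := \sum_j _.
have l2 : 0 < ln 2 :> R by rewrite ln_gt0 // ltr1n.
rewrite /E_lower; set S := [set h | _].
have u1 j : (1%:M : 'M[C]_(n j)) \in unitmx by exact: unitmx1.
have Sub : ubound S H.
  by move=> _ [A uA ->]; apply: entropy_theta_le => //; exact: tensor_act_neq0.
have Sn0 : S !=set0 by exists (entropy_theta theta (tensor_act (fun j => 1%:M) t));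
  exists (fun j => 1%:M).
have hS : has_sup S by split=> //; exists H.
apply/eqP; rewrite eq_le; apply/andP; split; first exact: ge_sup.
pose Cs := [set h | exists2 A : forall j, 'M[C]_(n j),
   forall j, A j \in unitmx & h = capfun A t].
have Cn0 : Cs !=set0 by exists (capfun (fun j => 1%:M) t); exists (fun j => 1%:M).
have Clb : lbound Cs c by move=> _ [A uA ->]; exact: hc.
have hC : has_inf Cs by split=> //; exists c.
have i0 : 0 < inf Cs by apply: lt_le_trans c0 _; exact: lb_le_inf.
(* A capacity within a factor [expR d] of its infimum gives defects at most [8 * d], hence a
   weighted entropy deficit of at most [K * d] bits. *)
pose K := \sum_j theta j * (8 * (n j)%:R / ln 2).
have K0 : 0 <= K.
  by apply: sumr_ge0 => j _; rewrite mulr_ge0 // divr_ge0 ?mulr_ge0 // ltW.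
have K1 : 0 < K + 1 by rewrite ltr_wpDl.
apply/ler_addgt0Pr => e e0; pose d := e / (K + 1).
have d0 : 0 < d by rewrite divr_gt0.
have [|_ [A uA ->] hA] := @inf_adherent _ Cs (inf Cs * (expR d - 1)) _ hC.
  by rewrite mulr_gt0 // subr_gt0 expR_gt1.
have {}hA : capfun A t <= inf Cs * expR d.
  by apply: le_trans (ltW hA) _; rewrite mulrBr mulr1 subrKC.
have hB (B : forall j, 'M[C]_(n j)) : (forall j, B j \in unitmx) ->
    inf Cs <= capfun B t.
  by move=> uB; apply: ge_inf; [exists c|exists B].
have v0 : tensor_act A t != 0 by exact: tensor_act_neq0.
have : H - K * d <= sup S.
  apply: (@le_trans _ _ (entropy_theta theta (tensor_act A t))); last first.
    by apply: ub_le_sup; [exists H|exists A].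
  rewrite mulr_suml -sumrB; apply: ler_sum => j _; rewrite -mulrA -mulrBr.
  rewrite ler_wpM2l // lerBlDr -lerBlDl -(ler_pM2l l2).
  have := defect_near_min j i0 t0 hB uA hA.
  have := entropy_gap_le v0 (n_gt0 j).
  set X := entropy _; set Y := marginal_defect _ _ => h1 h2.
  rewrite mulrBr /log2 mulrCA divff ?gt_eqF // mulr1; apply: (le_trans h1).
  rewrite [leRHS](_ : _ = (n j)%:R * (8 * d)).
    by rewrite ler_pM2l // ltr0n.
  by field; rewrite gt_eqF.
have : K * d <= e by rewrite /d mulrCA ger_pMr // ler_pdivrMr // mul1r; lra.
lra.
Qed.

End Scaling.

(** * Nonvanishing of polynomials along lines *)

Section PolynomialFunctions.
Variables (F : numFieldType) (N : nat).
Implicit Types (v a b : 'I_N -> F) (p q : mpoly.mpoly N F).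

Definition line a b (s : F) : 'I_N -> F := fun i => a i + s * (b i - a i).

Lemma meval_line q a b :
  exists P : {poly F}, forall s, P.[s] = mpoly.meval (line a b s) q.
Proof.
exists (\sum_(m <- mpoly.msupp q) (mpoly.mcoeff m q) *:
  \prod_i ((a i)%:P + (b i - a i) *: 'X) ^+ mpoly.fun_of_multinom m i) => s.
rewrite mpoly.mevalE horner_sum; apply: eq_bigr => m _.
rewrite hornerZ horner_prod; congr (_ * _); apply: eq_bigr => i _.
by rewrite horner_exp !hornerE mulrC.
Qed.

Lemma poly_nonroot_invn (P : {poly F}) m0 : P != 0 ->
  exists2 m, (m0 <= m)%N & P.[m.+1%:R^-1] != 0.
Proof.
move=> P0; pose rs := [seq ((m0 + i).+1%:R^-1 : F) | i <- iota 0 (size P)].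
have urs : uniq rs.
  rewrite map_inj_uniq ?iota_uniq // => x y /invr_inj/eqP.
  by rewrite eqr_nat eqSS eqn_add2l => /eqP.
have [ars|] := boolP (all (root P) rs).
  by have := max_poly_roots P0 ars urs; rewrite size_map size_iota ltnn.
case/allPn=> _ /mapP[i _ ->]; rewrite rootE => h.
by exists (m0 + i)%N; rewrite ?leq_addr.
Qed.

(** Euclidean density of a nonvanishing locus: on the line from [a] to [b] the polynomial has
    finitely many roots, while the parameters [m.+1%:R^-1] tend to 0. *)
Lemma meval_near p a b m0 : mpoly.meval b p != 0 ->
  exists2 m, (m0 <= m)%N & mpoly.meval (line a b m.+1%:R^-1) p != 0.
Proof.
move=> pb; have [P hP] := meval_line p a b.
have P0 : P != 0.
  apply: contraNneq pb => P0; rewrite -(@mpoly.meval_eq _ _ (line a b 1)).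
    by rewrite -hP P0 horner0.
  by move=> i; rewrite /line mul1r subrKC.
have [m mm0 Pm] := poly_nonroot_invn m0 P0.
by exists m; rewrite // -hP.
Qed.

(** Irreducibility of affine space: both polynomials restrict to nonzero univariate ones on the line
    through [a] and [b]. *)
Lemma meval_mul_neq0 p q a b : mpoly.meval a p != 0 -> mpoly.meval b q != 0 ->
  exists v, mpoly.meval v (p * q) != 0.
Proof.
move=> pa qb; have [P hP] := meval_line p a b; have [Q hQ] := meval_line q a b.
have P0 : P != 0.
  apply: contraNneq pa => P0; rewrite -(@mpoly.meval_eq _ _ (line a b 0)).
    by rewrite -hP P0 horner0.
  by move=> i; rewrite /line mul0r addr0.
have Q0 : Q != 0.
  apply: contraNneq qb => Q0; rewrite -(@mpoly.meval_eq _ _ (line a b 1)).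
    by rewrite -hQ Q0 horner0.
  by move=> i; rewrite /line mul1r subrKC.
have [m _ h] := poly_nonroot_invn 0 (mulf_neq0 P0 Q0).
exists (line a b m.+1%:R^-1); rewrite mpoly.mevalM -hP -hQ.
by rewrite -hornerM.
Qed.

Lemma meval_prod_neq0 (I : finType) (P : pred I) (q : I -> mpoly.mpoly N F) :
  (forall i, P i -> exists v, mpoly.meval v (q i) != 0) ->
  exists v, mpoly.meval v (\prod_(i | P i) q i) != 0.
Proof.
move=> h; elim/big_ind: _ => //.
  by exists (fun=> 0); rewrite mpoly.meval1 oner_eq0.
by move=> p1 p2 [v1 h1] [v2 h2]; exact: meval_mul_neq0 h1 h2.
Qed.

End PolynomialFunctions.

(** * Generic truth of first-order formulas *)

Section DefinableSets.
Variables (F : numClosedFieldType) (N : nat).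
Implicit Types (v : 'I_N -> F) (f : GRing.formula F).

Definition env v : seq F := [seq v i | i <- enum 'I_N].

Lemma size_env v : size (env v) = N.
Proof. by rewrite size_map size_enum_ord. Qed.

Lemma nth_env v (i : 'I_N) : (env v)`_i = v i.
Proof. by rewrite (nth_map i) ?size_enum_ord // nth_ord_enum. Qed.

(** A variable of index at least [N] becomes 0, the default value that [nth] reads off [env v]. *)
Fixpoint poly_of_term (t : GRing.term F) : mpoly.mpoly N F :=
  match t with
  | GRing.Var i =>
    if insub i is Some j then mpoly.mpolyX F (mpoly.mnm1 (j : 'I_N)) else 0
  | GRing.Const c => mpoly.mpolyC N c
  | GRing.NatConst m => 1 *+ m
  | GRing.Add a b => poly_of_term a + poly_of_term b
  | GRing.Opp a => - poly_of_term a
  | GRing.NatMul a m => poly_of_term a *+ m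
  | GRing.Mul a b => poly_of_term a * poly_of_term b
  | GRing.Inv a => 0
  | GRing.Exp a m => poly_of_term a ^+ m
  end.

Lemma meval_poly_of_term v t : GRing.rterm t ->
  mpoly.meval v (poly_of_term t) = GRing.eval (env v) t.
Proof.
elim: t => //=.
- move=> i _; case: insubP => [j _ <-|]; first by rewrite mpoly.mevalXU nth_env.
  by rewrite -leqNgt => Ni; rewrite mpoly.meval0 nth_default // size_env.
- by move=> c _; rewrite mpoly.mevalC.
- by move=> m _; rewrite mpoly.mevalMn mpoly.meval1.
- by move=> a IHa b IHb /andP[ra rb]; rewrite mpoly.mevalD IHa // IHb.
- by move=> a IHa ra; rewrite mpoly.mevalN IHa.
- by move=> a IHa m ra; rewrite mpoly.mevalMn IHa.
- by move=> a IHa b IHb /andP[ra rb]; rewrite mpoly.mevalM IHa // IHb.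
- move=> a IHa m ra; rewrite -IHa //; elim: m => [|m IHm].
    by rewrite !expr0 mpoly.meval1.
  by rewrite !exprS mpoly.mevalM IHm.
Qed.

(** An equation is either identically true or false off the zero set of its polynomial; for
    connectives the two polynomials are multiplied. *)
Let generic_qf f : GRing.qf_form f && GRing.rformula f ->
  exists2 q : mpoly.mpoly N F, (exists v, mpoly.meval v q != 0) &
    exists b : bool, forall v, mpoly.meval v q != 0 ->
      GRing.qf_eval (env v) f = b.
Proof.
have triv (b : bool) : exists2 q : mpoly.mpoly N F,
    (exists v, mpoly.meval v q != 0) & exists b' : bool,
      forall v, mpoly.meval v q != 0 -> b = b'.
  by exists 1; [exists (fun=> 0); rewrite mpoly.meval1 oner_eq0|exists b].
have comb f1 f2 (op : bool -> bool -> bool) :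
  (exists2 q : mpoly.mpoly N F, (exists v, mpoly.meval v q != 0) &
    exists b : bool, forall v, mpoly.meval v q != 0 ->
      GRing.qf_eval (env v) f1 = b) ->
  (exists2 q : mpoly.mpoly N F, (exists v, mpoly.meval v q != 0) &
    exists b : bool, forall v, mpoly.meval v q != 0 ->
      GRing.qf_eval (env v) f2 = b) ->
  exists2 q : mpoly.mpoly N F, (exists v, mpoly.meval v q != 0) &
    exists b : bool, forall v, mpoly.meval v q != 0 ->
      op (GRing.qf_eval (env v) f1) (GRing.qf_eval (env v) f2) = b.
  move=> [q1 [v1 h1] [b1 hb1]] [q2 [v2 h2] [b2 hb2]].
  exists (q1 * q2); first exact: meval_mul_neq0 h1 h2.
  exists (op b1 b2) => v; rewrite mpoly.mevalM mulf_eq0 negb_or.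
  by move=> /andP[/hb1 -> /hb2 ->].
elim: f => //=.
- move=> t1 t2 /andP[r1 r2].
  have e v : (GRing.eval (env v) t1 == GRing.eval (env v) t2) =
      (mpoly.meval v (poly_of_term t1 - poly_of_term t2) == 0).
    by rewrite mpoly.mevalB !meval_poly_of_term // subr_eq0.
  have [[v hv]|h] := pselect (exists v,
      mpoly.meval v (poly_of_term t1 - poly_of_term t2) != 0).
    exists (poly_of_term t1 - poly_of_term t2); first by exists v.
    by exists false => w hw; rewrite e (negbTE hw).
  exists 1; first by exists (fun=> 0); rewrite mpoly.meval1 oner_eq0.
  exists true => w _; rewrite e; apply: contrapT => /negP hw.
  by apply: h; exists w.
- move=> f1 IH1 f2 IH2 /andP[/andP[q1 q2] /andP[r1 r2]].
  by apply: (comb _ _ andb); [apply: IH1|apply: IH2]; apply/andP.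
- move=> f1 IH1 f2 IH2 /andP[/andP[q1 q2] /andP[r1 r2]].
  by apply: (comb _ _ orb); [apply: IH1|apply: IH2]; apply/andP.
- move=> f1 IH1 f2 IH2 /andP[/andP[q1 q2] /andP[r1 r2]].
  by apply: (comb _ _ implb); [apply: IH1|apply: IH2]; apply/andP.
- move=> f1 IH1 h1; have {}IH1 := IH1 h1.
  exact: (comb _ _ (fun b _ => ~~ b) IH1 IH1).
Qed.

(** Quantifier elimination over an algebraically closed field reduces this to [generic_qf]. *)
Lemma definable_generic f : GRing.rformula f ->
  exists2 q : mpoly.mpoly N F, (exists v, mpoly.meval v q != 0) &
    (forall v, mpoly.meval v q != 0 -> GRing.holds (env v) f) \/
    (forall v, mpoly.meval v q != 0 -> ~ GRing.holds (env v) f).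
Proof.
move=> rf; have wf := @ClosedFieldQE.wf_ex_elim F.
have ok := ClosedFieldQE.holds_ex_elim (@GRing.solve_monicpoly F).
have [q nq [b hb]] := generic_qf (GRing.quantifier_elim_wf wf rf).
exists q => //; case: b hb => hb; [left|right] => v /hb h.
  exact/(GRing.quantifier_elim_rformP wf ok (env v) rf).
by move/(GRing.quantifier_elim_rformP wf ok (env v) rf); rewrite h.
Qed.

End DefinableSets.

(** * Finite sums, products and conjunctions as syntax *)

Section Formulas.
Variable F : fieldType.
Implicit Types (e : seq F).

Definition sum_term (I : finType) (t : I -> GRing.term F) : GRing.term F :=
  foldr (fun i => GRing.Add (t i)) (GRing.Const 0) (enum I).

Definition prod_term (I : finType) (t : I -> GRing.term F) : GRing.term F :=
  foldr (fun i => GRing.Mul (t i)) (GRing.Const 1) (enum I).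

Definition all_formula (I : finType) (P : pred I) (f : I -> GRing.formula F) :=
  foldr (fun i => GRing.And (f i)) GRing.True (enum P).

Lemma eval_sum_term e (I : finType) (t : I -> GRing.term F) :
  GRing.eval e (sum_term t) = \sum_i GRing.eval e (t i).
Proof.
rewrite /sum_term -big_enum; elim: (enum I) => [|i r IHr] /=.
  by rewrite big_nil.
by rewrite big_cons IHr.
Qed.

Lemma eval_prod_term e (I : finType) (t : I -> GRing.term F) :
  GRing.eval e (prod_term t) = \prod_i GRing.eval e (t i).
Proof.
rewrite /prod_term -big_enum; elim: (enum I) => [|i r IHr] /=.
  by rewrite big_nil.
by rewrite big_cons IHr.
Qed.

Lemma holds_all_formula e (I : finType) (P : pred I) (f : I -> GRing.formula F) :
  GRing.holds e (all_formula P f) <-> (forall i, P i -> GRing.holds e (f i)).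
Proof.
rewrite /all_formula; split=> [h i Pi|].
  have: i \in enum P by rewrite mem_enum.
  elim: (enum P) h => //= j r IHr [hj hr]; rewrite inE => /predU1P[->//|].
  exact: IHr.
move=> h; have: {subset enum P <= P} by move=> i; rewrite mem_enum.
elim: (enum P) => //= j r IHr sr; split.
  by apply: h; apply: sr; rewrite mem_head.
by apply: IHr => i ir; apply: sr; rewrite inE ir orbT.
Qed.

Lemma rterm_sum (I : finType) (t : I -> GRing.term F) :
  (forall i, GRing.rterm (t i)) -> GRing.rterm (sum_term t).
Proof.
by move=> h; rewrite /sum_term; elim: (enum I) => //= i r ->; rewrite h.
Qed.

Lemma rterm_prod (I : finType) (t : I -> GRing.term F) :
  (forall i, GRing.rterm (t i)) -> GRing.rterm (prod_term t).
Proof.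
by move=> h; rewrite /prod_term; elim: (enum I) => //= i r ->; rewrite h.
Qed.

Lemma rformula_all (I : finType) (P : pred I) (f : I -> GRing.formula F) :
  (forall i, GRing.rformula (f i)) -> GRing.rformula (all_formula P f).
Proof.
by move=> h; rewrite /all_formula; elim: (enum P) => //= i r ->; rewrite h.
Qed.

Lemma rformula_exists f (s : seq nat) : GRing.rformula f ->
  GRing.rformula (foldr (@GRing.Exists F) f s).
Proof. by move=> rf; elim: s. Qed.

End Formulas.

(** * The null cone in first-order terms *)

Section NullDefinable.
Variables (R : realType) (k : nat) (n : 'I_k -> nat).
Notation C := R[i].
Implicit Types (t : tensor R n) (S : {set mindex n}).

Notation N := #|mindex n|.
Notation entry := {j : 'I_k & ('I_(n j) * 'I_(n j))%type}.
Notation M := #|{: entry}|.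

Let entry_of j (a b : 'I_(n j)) : entry :=
  Tagged (fun j => 'I_(n j) * 'I_(n j))%type (a, b).

(* Variables: the coordinates of [t] below [N], then the entries of the
   matrices [A j], then those of their inverses. *)
Let tvar (x : mindex n) : nat := enum_rank x.
Let avar j (a b : 'I_(n j)) : nat := (N + enum_rank (entry_of a b))%N.
Let bvar j (a b : 'I_(n j)) : nat := (N + (M + enum_rank (entry_of a b)))%N.

Let inverse_formula : GRing.formula C :=
  all_formula predT (fun j : 'I_k => all_formula predT (fun a : 'I_(n j) =>
    all_formula predT (fun c : 'I_(n j) => GRing.Equal
      (sum_term (fun b : 'I_(n j) =>
        GRing.Mul (GRing.Var C (avar a b)) (GRing.Var C (bvar b c))))
      (GRing.Const (a == c)%:R)))).

Let support_formula S : GRing.formula C :=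
  all_formula (fun x => x \notin S) (fun x : mindex n => GRing.Equal
    (sum_term (fun y : mindex n => GRing.Mul
       (prod_term (fun j => GRing.Var C (avar (x j) (y j)))) (GRing.Var C (tvar y))))
    (GRing.Const 0)).

(** Invertibility is stated through a quantified inverse, which avoids writing determinants. The
    condition [unstable] concerns real weights and an order, so it stays outside the formula: there
    is one formula for each support [S]. *)
Definition null_formula S : GRing.formula C :=
  foldr (@GRing.Exists C) (GRing.And inverse_formula (support_formula S))
    (iota N (M + M)).

Lemma null_formula_rformula S : GRing.rformula (null_formula S).
Proof.
apply: rformula_exists => /=; apply/andP; split.
  apply: rformula_all => j; apply: rformula_all => a; apply: rformula_all => c /=.
  by rewrite andbT; exact: rterm_sum.
apply: rformula_all => x /=; rewrite andbT; apply: rterm_sum => y /=.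
by rewrite andbT; exact: rterm_prod.
Qed.

Lemma null_formulaP S t :
  GRing.holds (env (tensor_coord t)) (null_formula S) <->
  exists2 A : forall j, 'M[C]_(n j), (forall j, A j \in unitmx) &
    forall x, x \notin S -> tensor_act A t x = 0.
Proof.
set e := env _; have et (y : mindex n) : e`_(tvar y) = t y.
  by rewrite nth_env /tensor_coord enum_rankK.
(* The meaning of the quantifier-free part in any environment that stores [t], [A] and [B] in their
   slots; both directions use it. *)
have body e' (A B : forall j, 'M[C]_(n j)) :
    (forall j a b, A j a b = e'`_(avar a b)) ->
    (forall j a b, B j a b = e'`_(bvar a b)) ->
    (forall y, e'`_(tvar y) = t y) ->
    GRing.holds e' (GRing.And inverse_formula (support_formula S)) <->
    (forall j, A j *m B j = 1%:M) /\
    (forall x, x \notin S -> tensor_act A t x = 0).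
  move=> hA hB ht; have hI : GRing.holds e' inverse_formula <->
      (forall j, A j *m B j = 1%:M).
    rewrite /inverse_formula; split=> [/holds_all_formula h j|h].
      apply/matrixP => a c; have /holds_all_formula := h j isT.
      move=> /(_ a isT) /holds_all_formula /(_ c isT) /=.
      rewrite eval_sum_term !mxE /= => <-.
      by apply: eq_bigr => b _; rewrite hA hB.
    apply/holds_all_formula => j _; apply/holds_all_formula => a _.
    apply/holds_all_formula => c _ /=; rewrite eval_sum_term /=.
    have /matrixP/(_ a c) := h j; rewrite !mxE => <-.
    by apply: eq_bigr => b _; rewrite hA hB.
  have hs : GRing.holds e' (support_formula S) <->
      (forall x, x \notin S -> tensor_act A t x = 0).
    have e0 (x : mindex n) : GRing.eval e' (sum_term (fun y : mindex n => GRing.Mul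
        (prod_term (fun j => GRing.Var C (avar (x j) (y j))))
        (GRing.Var C (tvar y)))) = tensor_act A t x.
      rewrite eval_sum_term ffunE; apply: eq_bigr => y _ /=.
      rewrite eval_prod_term ht; congr (_ * _).
      by apply: eq_bigr => j _ /=; rewrite hA.
    split=> [/holds_all_formula h x /h /=|h]; first by rewrite e0.
    by apply/holds_all_formula => x xS /=; rewrite e0 h.
  by split=> /= -[/hI h1 /hs h2].
rewrite /null_formula; split.
  move=> /GRing.foldExistsP[e' he'].
  pose A j : 'M[C]_(n j) := \matrix_(a, b) e'`_(avar a b).
  pose B j : 'M[C]_(n j) := \matrix_(a, b) e'`_(bvar a b).
  have hA j a b : A j a b = e'`_(avar a b) by rewrite mxE.
  have hB j a b : B j a b = e'`_(bvar a b) by rewrite mxE.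
  have ht (y : mindex n) : e'`_(tvar y) = t y.
    rewrite -et; apply/esym/he'; rewrite !inE mem_iota negb_and.
    by rewrite -ltnNge ltn_ord.
  move=> /(body e' A B hA hB ht)[AB h].
  by exists A => // j; have /mulmx1_unit[] := AB j.
move=> [A uA hA]; apply/GRing.foldExistsP.
pose eA := [seq A (tag i) (tagged i).1 (tagged i).2 | i : entry].
pose eB := [seq invmx (A (tag i)) (tagged i).1 (tagged i).2 | i : entry].
have se : size e = N by exact: size_env.
have sA : size eA = M by rewrite size_map -cardE.
have sB : size eB = M by rewrite size_map -cardE.
exists (e ++ eA ++ eB).
  (* Outside the quantified block, indices below [N] read the same entry of [e], and indices from
     [N + (M + M)] on read the default in both environments. *)
  move=> i; rewrite !inE mem_iota negb_and -ltnNge -leqNgt.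
  rewrite !nth_cat se sA => /orP[->//|Ni].
  have NM : (N <= N + (M + M))%N by exact: leq_addr.
  rewrite ltnNge (leq_trans NM Ni) /= nth_default ?se ?(leq_trans NM Ni) //.
  rewrite ltn_subLR ?(leq_trans NM Ni) // ltnNge.
  rewrite (leq_trans _ Ni) ?leq_add2l ?leq_addr //= nth_default //.
  rewrite sB -subnDA leq_subRL -?addnA //.
  by rewrite (leq_trans _ Ni) // addnA leq_addr.
apply/(body _ A (fun j => invmx (A j))) => //.
- move=> j a b; rewrite !nth_cat se sA ltnNge leq_addr /= addKn ltn_ord.
  by rewrite (nth_map (entry_of a b)) -?cardE ?ltn_ord // nth_enum_rank.
- move=> j a b; rewrite !nth_cat se sA ltnNge leq_addr /= addKn.
  rewrite ltnNge leq_addr /= addKn.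
  by rewrite (nth_map (entry_of a b)) -?cardE ?ltn_ord // nth_enum_rank.
- by move=> y; rewrite nth_cat se ltn_ord et.
by split=> // j; rewrite mulmxV.
Qed.

End NullDefinable.

(** * Euclidean continuity of polynomial functions on tensors *)

Section Continuity.
Variables (R : realType) (k : nat) (n : 'I_k -> nat).
Notation C := R[i].
Implicit Types (t : tensor R n) (f g : tensor R n -> C).

(** Ordinary continuity at [t], with squared distances on both sides so as to match [sqnorm]. *)
Definition continuous_at_tensor t f := forall e : R, 0 < e ->
  exists2 d : R, 0 < d &
    forall t', sqnorm (t - t') < d -> normsq (f t' - f t) < e.

Lemma continuous_at_cst t (c : C) : continuous_at_tensor t (fun=> c).
Proof.
by move=> e e0; exists 1 => // t' _; rewrite subrr /normsq /= expr0n addr0.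
Qed.

Lemma continuous_at_coord t x : continuous_at_tensor t (fun u => u x).
Proof.
move=> e e0; exists e => // t'; apply: le_lt_trans.
rewrite -normsqN opprB /sqnorm (bigD1 x) //= !ffunE lerDl.
by apply: sumr_ge0 => y _; exact: normsq_ge0.
Qed.

Lemma continuous_atD t f g : continuous_at_tensor t f ->
  continuous_at_tensor t g -> continuous_at_tensor t (fun u => f u + g u).
Proof.
move=> cf cg e e0; have e4 : 0 < e / 4 by rewrite divr_gt0.
have [d1 d10 h1] := cf _ e4; have [d2 d20 h2] := cg _ e4.
exists (Num.min d1 d2); first by rewrite lt_min d10.
move=> t'; rewrite lt_min => /andP[/h1 {}h1 /h2 {}h2].
rewrite opprD addrACA; apply: le_lt_trans (normsqD_le _ _) _; lra.
Qed.

Lemma continuous_atM t f g : continuous_at_tensor t f ->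
  continuous_at_tensor t g -> continuous_at_tensor t (fun u => f u * g u).
Proof.
move=> cf cg e e0.
pose K := 1 + normsq (f t) + normsq (g t).
have K1 : 1 <= K by rewrite /K -addrA lerDl addr_ge0 ?normsq_ge0.
have K0 : 0 < K by apply: lt_le_trans K1.
(* With [a], [b] the squared moduli of [f t], [g t], the error is at most [r * (2 + 4 * a + 4 * b)],
   which is below [r * (16 * K)]. *)
pose r := Num.min 1 (e / (16 * K)).
have r0 : 0 < r by rewrite lt_min ltr01 divr_gt0 // mulr_gt0.
have [d1 d10 h1] := cf _ r0; have [d2 d20 h2] := cg _ r0.
exists (Num.min d1 d2); first by rewrite lt_min d10.
move=> t'; rewrite lt_min => /andP[/h1 {}h1 /h2 {}h2].
have rK : r * (16 * K) <= e.
  by rewrite -ler_pdivlMr ?mulr_gt0 // /r ge_min lexx orbT.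
have r1 : r <= 1 by rewrite /r ge_min lexx.
rewrite (_ : f t' * g t' - f t * g t = (f t' - f t) * (g t' - g t) +
  (f t * (g t' - g t) + (f t' - f t) * g t)); last by ring.
apply: le_lt_trans (normsqD_le _ _) _.
have := normsqD_le (f t * (g t' - g t)) ((f t' - f t) * g t).
rewrite !normsqM; move: h1 h2 rK; rewrite /K.
have := normsq_ge0 (f t' - f t); have := normsq_ge0 (g t' - g t).
have := normsq_ge0 (f t); have := normsq_ge0 (g t).
set x := normsq (f t' - f t); set y := normsq (g t' - g t).
set a := normsq (f t); set b := normsq (g t) => b0 a0 y0 x0 xr yr rK h.
have xy : x * y <= r by rewrite -[leRHS]mulr1 ler_pM // ?ltW // (lt_le_trans yr).
have ay : a * y <= a * r by rewrite ler_wpM2l // ltW.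
have xb : x * b <= r * b by rewrite ler_wpM2r // ltW.
have ra : 0 <= r * a by rewrite mulr_ge0 // ltW.
have rb : 0 <= r * b by rewrite mulr_ge0 // ltW.
nra.
Qed.

Lemma continuous_at_meval t (q : mpoly.mpoly #|mindex n| C) :
  continuous_at_tensor t (fun u => mpoly.meval (tensor_coord u) q).
Proof.
have -> : (fun u => mpoly.meval (tensor_coord u) q) =
   (fun u => \sum_(m <- mpoly.msupp q) mpoly.mcoeff m q *
     \prod_i tensor_coord u i ^+ mpoly.fun_of_multinom m i).
  by apply/funext => u; rewrite mpoly.mevalE.
elim: (mpoly.msupp q) => [|m r IHr].
  rewrite (_ : (fun u => _) = fun=> 0); first exact: continuous_at_cst.
  by apply/funext => u; rewrite big_nil.
rewrite (_ : (fun u => _) = (fun u => mpoly.mcoeff m q *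
     \prod_i tensor_coord u i ^+ mpoly.fun_of_multinom m i +
     \sum_(m <- r) mpoly.mcoeff m q *
     \prod_i tensor_coord u i ^+ mpoly.fun_of_multinom m i)); last first.
  by apply/funext => u; rewrite big_cons.
apply: continuous_atD IHr; apply: continuous_atM; first exact: continuous_at_cst.
elim: (index_enum _) => [|i s IHs].
  rewrite (_ : (fun u => _) = fun=> 1); first exact: continuous_at_cst.
  by apply/funext => u; rewrite big_nil.
rewrite (_ : (fun u => _) = (fun u => tensor_coord u i ^+ mpoly.fun_of_multinom m i *
   \prod_(i <- s) tensor_coord u i ^+ mpoly.fun_of_multinom m i)); last first.
  by apply/funext => u; rewrite big_cons.
apply: continuous_atM IHs; elim: (mpoly.fun_of_multinom m i) => [|d IHd].
  rewrite (_ : (fun u => _) = fun=> 1); first exact: continuous_at_cst.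
  by apply/funext => u; rewrite expr0.
rewrite (_ : (fun u => _) = (fun u => tensor_coord u i * tensor_coord u i ^+ d)).
  by apply: continuous_atM IHd; exact: continuous_at_coord.
by apply/funext => u; rewrite exprS.
Qed.

Lemma meval_open t (q : mpoly.mpoly #|mindex n| C) :
  mpoly.meval (tensor_coord t) q != 0 -> exists2 d : R, 0 < d &
    forall t', sqnorm (t - t') < d -> mpoly.meval (tensor_coord t') q != 0.
Proof.
rewrite -normsq_gt0 => q0; have [d d0 hd] := @continuous_at_meval t q _ q0.
exists d => // t' /hd; apply: contraTneq => ->.
by rewrite sub0r normsqN ltxx.
Qed.

End Continuity.

(** * The generic value in the presence of a mixed state *)

Section GenericValue.
Variables (R : realType) (k : nat) (n : 'I_k -> nat).
Hypothesis n_gt0 : forall j, (0 < n j)%N.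
Notation C := R[i].
Notation poly := (mpoly.mpoly #|mindex n| C).
Implicit Types (t psi : tensor R n) (q : poly).

Lemma completely_mixedP psi : completely_mixed_marginals psi <-> mixed psi.
Proof.
have e1 : inner psi psi = 1 <-> sqnorm psi = 1.
  rewrite -sqnormE; split=> [h|->//]; exact: complexI.
split=> [[/e1 p1 h]|[p1 h]]; split=> //; try exact/e1; move=> j;
    have p0 := sqnorm1_neq0 p1.
  apply: marginal_defect_eq0; apply/(entropy_maxP p0 (n_gt0 j)); exact: h.
apply/(entropy_maxP p0 (n_gt0 j)); rewrite /marginal_defect h subrr.
apply: big1 => a _; apply: big1 => b _; apply/eqP.
by rewrite normsq_eq0 mxE.
Qed.

Let tensor_of (v : 'I_#|mindex n| -> C) : tensor R n :=
  [ffun x => v (enum_rank x)].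

Let tensor_ofK v : tensor_coord (tensor_of v) =1 v.
Proof. by move=> i; rewrite /tensor_coord ffunE enum_valK. Qed.

Lemma sqnorm_lt_near psi (v : 'I_#|mindex n| -> C) (c : R) : 0 < c ->
  exists m0, forall m, (m0 <= m)%N ->
    sqnorm (psi - tensor_of (line (tensor_coord psi) v m.+1%:R^-1)) <= c.
Proof.
move=> c0; pose K := \sum_x normsq (v (enum_rank x) - psi x).
have K0 : 0 <= K by apply: sumr_ge0 => x _; exact: normsq_ge0.
have [m0 hm0] : exists m0 : nat, K / c < m0%:R.
  by exists (Num.truncn (K / c)).+1; rewrite truncnS_gt.
exists m0 => m mm0.
have -> : sqnorm (psi - tensor_of (line (tensor_coord psi) v m.+1%:R^-1)) =
    m.+1%:R^-1 ^+ 2 * K.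
  rewrite mulr_sumr; apply: eq_bigr => x _.
  rewrite !ffunE /line /tensor_coord enum_rankK opprD addNKr normsqN normsqM.
  congr (_ * _); rewrite -normsqC; congr normsq.
  by rewrite fmorphV rmorph_nat.
have m1 : 1 <= m.+1%:R :> R by rewrite ler1n.
have h : K <= c * m.+1%:R.
  rewrite mulrC -ler_pdivrMr // (le_trans (ltW hm0)) // ler_nat.
  exact: leqW.
rewrite exprVn mulrC ler_pdivrMr ?exprn_gt0 ?ltr0n //.
apply: (le_trans h); rewrite ler_pM2l // expr2 ler_peMl //.
Qed.

(** For each unstable [S] the formula is generically true or generically false, and a mixed state
    rules out the former; the product over the finitely many unstable [S] is the required
    polynomial. *)
Lemma not_null_generic psi : mixed psi -> exists2 q : poly,
  exists t, mpoly.meval (tensor_coord t) q != 0 &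
  forall t, mpoly.meval (tensor_coord t) q != 0 -> ~ null t.
Proof.
move=> mpsi; have [c c0 hc] := capfun_near_mixed n_gt0 mpsi.
have H (S : {set mindex n}) : exists q : poly,
    (exists v, mpoly.meval v q != 0) /\ (unstable R S ->
    forall t, mpoly.meval (tensor_coord t) q != 0 ->
    ~ GRing.holds (env (tensor_coord t)) (null_formula R S)).
  have [q [v hv] [h|h]] :=
    @definable_generic _ #|mindex n| _ (null_formula_rformula R S).
    (* If the formula is generically true, it holds at points arbitrarily close to [psi]. For
       unstable [S] these are null, against the bound [c] on their capacity; so [S] is not unstable
       and any nonzero polynomial will do. *)
    exists 1; split; first by exists v; rewrite mpoly.meval1 oner_eq0.
    move=> uS; have [m0 hm0] := sqnorm_lt_near psi v c0.
    have [m mm0] := meval_near (tensor_coord psi) m0 hv.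
    set t := tensor_of (line (tensor_coord psi) v m.+1%:R^-1) => hq.
    have {}hq : mpoly.meval (tensor_coord t) q != 0.
      by rewrite (mpoly.meval_eq _ (tensor_ofK _)).
    have /null_formulaP[A uA At0] := h _ hq.
    have nt : null t by exists S => //; exists A.
    have [B uB] := null_capfun c0 nt.
    by rewrite ltNge hc // hm0.
  by exists q; split; [exists v|move=> _ t; exact: h].
have [q hq] := boolp.choice H.
have [|v hv] := @meval_prod_neq0 _ _ _ (fun S => `[< unstable R S >]) q.
  by move=> S _; case: (hq S).
exists (\prod_(S | `[< unstable R S >]) q S).
  by exists (tensor_of v); rewrite (mpoly.meval_eq _ (tensor_ofK _)).
move=> t ht [S uS hS]; have /asboolP bS := uS; apply: ((hq S).2 uS t).
  move: ht; rewrite (bigD1 S) //= mpoly.mevalM mulf_eq0 negb_or.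
  by case/andP.
exact/null_formulaP.
Qed.

Lemma prod_powR (theta : 'I_k -> R) :
  2 `^ (\sum_j theta j * log2 (n j)%:R) = \prod_j ((n j)%:R `^ theta j) :> R.
Proof.
have l2 : ln 2 != 0 :> R by rewrite gt_eqF // ln_gt0 // ltr1n.
rewrite /powR pnatr_eq0 /= mulr_suml expR_sum; apply: eq_bigr => j _.
by rewrite pnatr_eq0 gtn_eqF // /log2 -mulrA divfK.
Qed.

Lemma F_lower_max (theta : 'I_k -> R) t (c : R) : (forall j, 0 <= theta j) ->
  0 < c ->
  (forall A : forall j, 'M[C]_(n j), (forall j, A j \in unitmx) ->
    c <= capfun A t) ->
  F_lower theta t = \prod_j ((n j)%:R `^ theta j).
Proof.
move=> th0 c0 hc; have t0 : t != 0.
  rewrite -sqnorm_gt0 -(tensor_act1 t).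
  have := hc (fun j => 1%:M) (fun j => unitmx1 _ _); rewrite /capfun => h.
  by have := lt_le_trans c0 h; rewrite pmulr_lgt0 // expR_gt0.
by rewrite /F_lower (negbTE t0) (E_lower_max n_gt0 th0 t0 c0 hc) prod_powR.
Qed.

(** If [q] does not vanish at [t], it does not vanish on a Euclidean ball around [t]. A capacity
    with infimum 0 would put a null tensor in that ball. *)
Lemma mixed_generic_value (theta : 'I_k -> R) psi : (forall j, 0 <= theta j) ->
  mixed psi -> is_generic_value n theta (\prod_j ((n j)%:R `^ theta j)).
Proof.
move=> th0 /not_null_generic[q [t0 q0] hq].
exists [set t | mpoly.meval (tensor_coord t) q != 0]; split.
- exists [set q]; apply/seteqP; split=> t /=.
    by move=> /negP; rewrite negbK => /eqP h p ->.
  by move=> /(_ q erefl) ->; rewrite eqxx.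
- by exists t0.
move=> t /= qt.
have [[c c0 hc]|h] := pselect (exists2 c : R, 0 < c &
    forall A : forall j, 'M[C]_(n j), (forall j, A j \in unitmx) ->
    c <= capfun A t); first exact: F_lower_max hc.
have [d d0 hd] := meval_open qt.
have [|t' nt' tt'] := null_near n_gt0 d0 (t := t).
  move=> e e0; apply: contrapT => he; apply: h; exists e => // A uA.
  by rewrite leNgt; apply/negP => hA; apply: he; exists A.
by case: (hq t' (hd t' tt') nt').
Qed.

(** Every nonempty Zariski open set contains the nonvanishing locus of one polynomial, and two such
    loci meet. *)
Lemma is_generic_value_unique (theta : 'I_k -> R) (c1 c2 : R) :
  is_generic_value n theta c1 -> is_generic_value n theta c2 -> c1 = c2.
Proof.
have H (U : set (tensor R n)) : zariski_open U -> U !=set0 ->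
    exists2 q : poly, exists t, mpoly.meval (tensor_coord t) q != 0 &
    forall t, mpoly.meval (tensor_coord t) q != 0 -> U t.
  move=> [S hS] [t Ut]; have : ~ (~` U) t by [].
  rewrite hS /= => /existsNP[p /not_implyP[Sp /eqP pt]].
  exists p; first by exists t.
  move=> u pu; apply: contrapT => nUu; have : (~` U) u by [].
  by rewrite hS /= => /(_ p Sp) pu0; rewrite pu0 eqxx in pu.
move=> [U1 [/H h1 /h1[q1 [t1 qt1] hU1] F1]] [U2 [/H h2 /h2[q2 [t2 qt2] hU2] F2]].
have [v] := meval_mul_neq0 qt1 qt2.
rewrite -(mpoly.meval_eq _ (tensor_ofK v)) mpoly.mevalM mulf_eq0 negb_or.
by move=> /andP[/hU1 u1 /hU2 u2]; rewrite -(F1 _ u1) -(F2 _ u2).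
Qed.

End GenericValue.

(** * Continuity of complex-valued maps through real and imaginary parts *)

Section ComplexContinuity.
Variables (R : realType) (T : topologicalType).
Notation C := R[i].
Implicit Types f g : T -> C.

Definition ccontinuous f :=
  continuous (fun r => complex.Re (f r)) /\
  continuous (fun r => complex.Im (f r)).

Lemma ccontinuous_cst (c : C) : ccontinuous (fun=> c).
Proof. by split=> r; exact: cvg_cst. Qed.

Lemma ccontinuousD f g : ccontinuous f -> ccontinuous g ->
  ccontinuous (fun r => f r + g r).
Proof.
move=> [f1 f2] [g1 g2]; split=> r.
  rewrite (_ : (fun r => _) = (fun r => complex.Re (f r) + complex.Re (g r))).
    by apply: cvgD; [exact: f1|exact: g1].
  by apply/funext => s; rewrite raddfD.
rewrite (_ : (fun r => _) = (fun r => complex.Im (f r) + complex.Im (g r))).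
  by apply: cvgD; [exact: f2|exact: g2].
by apply/funext => s; rewrite raddfD.
Qed.

Lemma ccontinuousM f g : ccontinuous f -> ccontinuous g ->
  ccontinuous (fun r => f r * g r).
Proof.
move=> [f1 f2] [g1 g2]; split=> r.
  rewrite (_ : (fun r => _) = (fun r => complex.Re (f r) * complex.Re (g r) -
      complex.Im (f r) * complex.Im (g r))).
    by apply: cvgB; apply: cvgM; [exact: f1|exact: g1|exact: f2|exact: g2].
  by apply/funext => s; case: (f s); case: (g s).
rewrite (_ : (fun r => _) = (fun r => complex.Re (f r) * complex.Im (g r) +
    complex.Im (f r) * complex.Re (g r))).
  by apply: cvgD; apply: cvgM; [exact: f1|exact: g2|exact: f2|exact: g1].
by apply/funext => s; case: (f s); case: (g s).
Qed.

Lemma ccontinuous_conj f : ccontinuous f -> ccontinuous (fun r => (f r)^*).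
Proof.
move=> [f1 f2]; split=> r.
  rewrite (_ : (fun r => _) = (fun r => complex.Re (f r))); first exact: f1.
  by apply/funext => s; case: (f s).
rewrite (_ : (fun r => _) = (fun r => - complex.Im (f r))).
  by apply: cvgN; exact: f2.
by apply/funext => s; case: (f s).
Qed.

Lemma ccontinuous_sum (I : Type) (s : seq I) (P : pred I) (f : I -> T -> C) :
  (forall i, ccontinuous (f i)) ->
  ccontinuous (fun r => \sum_(i <- s | P i) f i r).
Proof.
move=> cf; elim: s => [|i s IHs].
  rewrite (_ : (fun r => _) = fun=> 0); first exact: ccontinuous_cst.
  by apply/funext => r; rewrite big_nil.
rewrite (_ : (fun r => _) = (fun r =>
    (if P i then f i r else 0) + \sum_(i <- s | P i) f i r)).
  apply: ccontinuousD IHs; case: (P i) => //; exact: ccontinuous_cst.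
by apply/funext => r; rewrite big_cons; case: ifP => // _; rewrite add0r.
Qed.

Lemma continuous_normsq f : ccontinuous f -> continuous (fun r => normsq (f r)).
Proof.
move=> [f1 f2] r.
rewrite (_ : (fun r => _) = (fun r => complex.Re (f r) * complex.Re (f r) +
    complex.Im (f r) * complex.Im (f r))); last by apply/funext => s; rewrite -!expr2.
by apply: cvgD; apply: cvgM; [exact: f1|exact: f1|exact: f2|exact: f2].
Qed.

Lemma continuous_bigsum (I : Type) (s : seq I) (P : pred I) (f : I -> T -> R) :
  (forall i, continuous (f i)) ->
  continuous (fun r => \sum_(i <- s | P i) f i r).
Proof.
move=> cf; elim: s => [|i s IHs] r.
  rewrite (_ : (fun r => _) = fun=> 0); first exact: cvg_cst.
  by apply/funext => u; rewrite big_nil.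
rewrite (_ : (fun r => _) = (fun r =>
    (if P i then f i r else 0) + \sum_(i <- s | P i) f i r)).
  apply: cvgD; last exact: IHs.
  by case: (P i) => //; [exact: cf|exact: cvg_cst].
by apply/funext => u; rewrite big_cons; case: ifP => // _; rewrite add0r.
Qed.

End ComplexContinuity.

(** * Existence of a mixed state by compactness of the unit sphere *)

Section SphereCompactness.
Variables (R : realType) (k : nat) (n : 'I_k -> nat).
Hypothesis n_gt0 : forall j, (0 < n j)%N.
Notation C := R[i].
Notation N := #|mindex n|.
Implicit Types (t psi : tensor R n) (r : 'rV[R]_(N + N)).

(** Real coordinates, all real parts before all imaginary parts, make compactness of cubes of real
    row vectors available. *)
Let tensor_of_rV r : tensor R n := [ffun x =>
  (r 0 (lshift N (enum_rank x)) +i* r 0 (rshift N (enum_rank x)))%C].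

Let rV_of_tensor t : 'rV[R]_(N + N) := row_mx
  (\row_i complex.Re (t (enum_val i))) (\row_i complex.Im (t (enum_val i))).

Let rV_of_tensorK t : tensor_of_rV (rV_of_tensor t) = t.
Proof.
apply/ffunP => x; rewrite ffunE /rV_of_tensor row_mxEl row_mxEr !mxE enum_rankK.
by case: (t x).
Qed.

Let ccontinuous_coord x : ccontinuous (fun r => tensor_of_rV r x).
Proof.
split=> r.
  rewrite (_ : (fun r => _) = (fun r => r 0 (lshift N (enum_rank x)))).
    exact: coord_continuous.
  by apply/funext => s; rewrite ffunE.
rewrite (_ : (fun r => _) = (fun r => r 0 (rshift N (enum_rank x)))).
  exact: coord_continuous.
by apply/funext => s; rewrite ffunE.
Qed.

Let sphere : set 'rV[R]_(N + N) := [set r | sqnorm (tensor_of_rV r) = 1].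

Let continuous_sqnorm : continuous (fun r => sqnorm (tensor_of_rV r)).
Proof.
by apply: continuous_bigsum => x; apply: continuous_normsq; exact: ccontinuous_coord.
Qed.

Let sphere_compact : compact sphere.
Proof.
pose B : set 'rV[R]_(N + N) := [set v | forall i, `[(-1 : R), 1]%classic (v ord0 i)].
have cB : compact B.
  by apply: (@rV_compact _ _ (fun=> `[(-1 : R), 1]%classic)) => _; exact: segment_compact.
apply: (subclosed_compact _ cB).
  rewrite (_ : sphere = (fun r => sqnorm (tensor_of_rV r)) @^-1` [set 1]) //.
  by apply: closed_comp => [r _|]; [exact: continuous_sqnorm|exact: closed_eq].
move=> r /= r1 i; rewrite /= in_itv /= -ler_norml -(@expr_le1 _ 2) //.
rewrite -normrX ger0_norm ?sqr_ge0 //.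
rewrite -r1 /sqnorm.
have h x : normsq (tensor_of_rV r x) <= \sum_x normsq (tensor_of_rV r x).
  rewrite [leRHS](bigD1 x) //= lerDl.
  by apply: sumr_ge0 => y _; exact: normsq_ge0.
case: (splitP i) => a ia.
  apply: le_trans (h (enum_val a)); rewrite ffunE /normsq /= enum_valK.
  by rewrite (_ : lshift N a = i) ?lerDl ?sqr_ge0 //; apply: val_inj.
apply: le_trans (h (enum_val a)); rewrite ffunE /normsq /= enum_valK.
by rewrite (_ : rshift N a = i) ?lerDr ?sqr_ge0 //; apply: val_inj.
Qed.

(* Without the normalisation of [density], whose quotient is not continuous
   at 0; both agree on unit vectors. *)
Let unit_defect t j : R := \sum_a \sum_b
  normsq ((marginal (fun x y => t x * (t y)^*) j - ((n j)%:R^-1)%:C%C%:M) a b).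

Let unit_defectE t j : sqnorm t = 1 -> unit_defect t j = marginal_defect t j.
Proof.
move=> t1; rewrite /unit_defect /marginal_defect (_ : density t = fun x y => t x * (t y)^*) //.
by apply/funext => x; apply/funext => y; rewrite /density -sqnormE t1 divr1.
Qed.

Let continuous_unit_defect j : continuous (fun r => unit_defect (tensor_of_rV r) j).
Proof.
apply: continuous_bigsum => a; apply: continuous_bigsum => b.
apply: continuous_normsq.
rewrite (_ : (fun r => _) = (fun r => \sum_(x : mindex n | x j == a)
    \sum_(y : mindex n | (y j == b) && [forall (i | i != j), x i == y i])
      tensor_of_rV r x * (tensor_of_rV r y)^* +
    (- ((n j)%:R^-1)%:C%C%:M : 'M[C]_(n j)) a b)); last first.
  by apply/funext => r; rewrite !mxE.
apply: ccontinuousD; last exact: ccontinuous_cst.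
apply: ccontinuous_sum => x; apply: ccontinuous_sum => y.
apply: ccontinuousM; first exact: ccontinuous_coord.
apply: ccontinuous_conj; exact: ccontinuous_coord.
Qed.

Lemma normalize t : t != 0 -> exists2 u : tensor R n, sqnorm u = 1 &
  density u = density t.
Proof.
rewrite -sqnorm_gt0 => t0; pose s := Num.sqrt (sqnorm t).
have s2 : s ^+ 2 = sqnorm t by rewrite sqr_sqrtr // ltW.
have s0 : s != 0 by rewrite gt_eqF // sqrtr_gt0.
pose u : tensor R n := [ffun x => (s^-1)%:C%C * t x].
have nu : sqnorm u = 1.
  rewrite /sqnorm; under eq_bigr => x _ do rewrite ffunE normsqM normsqC.
  by rewrite -mulr_sumr -/(sqnorm t) exprVn s2 mulVf // gt_eqF.
exists u => //; apply/funext => x; apply/funext => y.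
rewrite /density -!sqnormE nu divr1 !ffunE rmorphM /= conj_real_complex.
rewrite mulrACA -real_complexM -expr2 exprVn s2 mulrC; congr (_ * _).
by rewrite fmorphV.
Qed.

(** The total defect is continuous on the compact unit sphere, so it attains its minimum;
    arbitrarily small values force the minimum to be 0. *)
Lemma mixed_of_small_defect :
  (forall e : R, 0 < e -> exists2 t : tensor R n, t != 0 & \sum_j marginal_defect t j < e) ->
  exists psi : tensor R n, mixed psi.
Proof.
move=> H.
have H' (e : R) : 0 < e -> exists2 u : tensor R n, sqnorm u = 1 &
    \sum_j unit_defect u j < e.
  move=> /H[t /normalize[u u1 ut] te]; exists u => //.
  apply: le_lt_trans te; apply: ler_sum => j _.
  by rewrite unit_defectE // /marginal_defect ut.
have S0 : sphere !=set0.
  have [u u1 _] := H' 1 ltr01.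
  by exists (rV_of_tensor u); rewrite /sphere /= rV_of_tensorK.
have cG : {within sphere, continuous (fun r => \sum_j unit_defect (tensor_of_rV r) j)}.
  apply: continuous_subspaceT; apply: continuous_bigsum => j.
  exact: continuous_unit_defect.
have [c /set_mem c1 hc] := compact_EVT_min S0 sphere_compact cG.
set psi := tensor_of_rV c in c1 hc; rewrite /sphere /= in c1.
exists psi; split=> // j; apply: marginal_defect_eq0.
have d0 i : 0 <= marginal_defect psi i by exact: marginal_defect_ge0.
have : \sum_j unit_defect psi j <= 0.
  rewrite leNgt; apply/negP => /H'[u u1]; rewrite ltNge => /negP; apply.
  have := hc (rV_of_tensor u); rewrite rV_of_tensorK; apply.
  by apply/mem_set; rewrite /sphere /= rV_of_tensorK.
under eq_bigr => i _ do rewrite unit_defectE //.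
move=> h; apply/eqP; rewrite eq_le d0 andbT; apply: le_trans h.
rewrite (bigD1 j) //= lerDl; exact: sumr_ge0.
Qed.

(** The supremum of the weighted entropies equals their upper bound, and no marginal exceeds its own
    bound; hence along the orbit all deficits become small together. *)
Lemma mixed_of_F_lower (theta : 'I_k -> R) t : (forall j, 0 < theta j) ->
  F_lower theta t = \prod_j ((n j)%:R `^ theta j) -> exists psi : tensor R n, mixed psi.
Proof.
move=> th0 Ft; have th0' j : 0 <= theta j by exact: ltW.
have l2 : 0 < ln 2 :> R by rewrite ln_gt0 // ltr1n.
have P0 : 0 < \prod_j ((n j)%:R `^ theta j).
  by apply: prodr_gt0 => j _; rewrite powR_gt0 // ltr0n.
have t0 : t != 0.
  by apply: contraTneq P0 => t0; rewrite -Ft /F_lower t0 eqxx ltxx.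
pose H := \sum_j theta j * log2 (n j)%:R.
have EH : E_lower theta t = H.
  move: Ft; rewrite /F_lower (negbTE t0) -prod_powR // /powR pnatr_eq0 /=.
  by move/expR_inj/mulIf; apply; rewrite gt_eqF.
apply: mixed_of_small_defect => e e0.
(* Positivity of every [theta j] enters here: a small weighted deficit bounds each single deficit up
   to the factor [th^-1]. *)
pose th := \big[Num.min/1]_j theta j.
have th_gt0 : 0 < th.
  rewrite /th; elim/big_ind: _ => //.
  by move=> x y; rewrite lt_min => -> ->.
(* Chosen so that [4 * ln 2 / th], the factor from weighted entropy deficit to total defect, carries
   [d] to [e]. *)
pose d := th * e / (4 * ln 2).
have d0 : 0 < d by rewrite divr_gt0 ?mulr_gt0.
have hS : has_sup [set h | exists2 A : forall j, 'M[C]_(n j),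
    forall j, A j \in unitmx & h = entropy_theta theta (tensor_act A t)].
  split.
    by exists (entropy_theta theta (tensor_act (fun j => 1%:M) t));
      exists (fun j => 1%:M) => // j; exact: unitmx1.
  exists H => _ [A uA ->]; apply: entropy_theta_le => //.
  exact: tensor_act_neq0.
have [_ [A uA ->]] := sup_adherent d0 hS; rewrite -/(E_lower theta t) EH => hA.
exists (tensor_act A t); first exact: tensor_act_neq0.
set v := tensor_act A t in hA *; have v0 : v != 0 by exact: tensor_act_neq0.
have hd j : marginal_defect v j <=
    4 * ln 2 / th * (theta j * (log2 (n j)%:R - entropy (marginal (density v) j))).
  have := entropy_gap_ge v0 (n_gt0 j).
  rewrite ler_pdivrMr // => h; apply: (le_trans h).
  have -> : ln (n j)%:R - ln 2 * entropy (marginal (density v) j) =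
      ln 2 * (log2 (n j)%:R - entropy (marginal (density v) j)).
    by rewrite mulrBr /log2 mulrCA divff ?gt_eqF // mulr1.
  set X := log2 _ - _.
  have X0 : 0 <= X by rewrite subr_ge0; exact: entropy_le.
  rewrite [leRHS](_ : _ = ln 2 * X * 4 * (theta j / th)); last by ring.
  rewrite ler_peMr ?mulr_ge0 ?(ltW l2) // ler_pdivlMr // mul1r.
  by rewrite /th (bigD1 j) //= ge_min lexx.
apply: le_lt_trans (ler_sum _ (fun j _ => hd j)) _.
rewrite -mulr_sumr; under eq_bigr => j _ do rewrite mulrBr.
rewrite sumrB -/H -/(entropy_theta theta v) mulrC.
rewrite -ltr_pdivlMr ?divr_gt0 ?mulr_gt0 //.
have -> : e / (4 * ln 2 / th) = d.
  by rewrite /d; field; rewrite !gt_eqF.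
lra.
Qed.

End SphereCompactness.

Theorem theorem4p31 (R : realType) (k : nat) (n : 'I_k -> nat)
    (theta : 'I_k -> R) (k_ge3 : (3 <= k)%N) (n_gt0 : forall j, (0 < n j)%N)
    (theta_distr : prob_distr theta) (theta_gt0 : forall j, 0 < theta j) :
  generic_value n theta = \prod_j ((n j)%:R `^ theta j) <->
  exists psi : tensor R n, completely_mixed_marginals psi.
Proof.
have P0 : 0 < \prod_j ((n j)%:R `^ theta j).
  by apply: prodr_gt0 => j _; rewrite powR_gt0 // ltr0n.
have th0 j : 0 <= theta j by exact: ltW.
split=> [h|[psi /(completely_mixedP n_gt0) mpsi]].
  have [[c hc]|nc] := pselect (exists c, is_generic_value n theta c).
    have [U [_ [t Ut] /(_ t Ut) Ft]] : is_generic_value n theta (generic_value n theta).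
      exact: (xgetI 0 hc).
    have [psi mpsi] : exists psi : tensor R n, mixed psi.
      by apply: (mixed_of_F_lower n_gt0 theta_gt0 (t := t)); rewrite Ft.
    by exists psi; apply/completely_mixedP.
  (* If no generic value existed, [xget] would return 0, which differs from the positive product. *)
  move: P0; rewrite -h /generic_value xgetPN ?ltxx // => c hc.
  by apply: nc; exists c.
have g := mixed_generic_value n_gt0 th0 mpsi.
apply: (is_generic_value_unique _ g); exact: (xgetI 0 g).
Qed.
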